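(* Let $f=(f_1,\dots,f_n)$ be an $n$-tuple of formal power series in the class $\mathcal M^b$ and let $T=(T_1,\dots,T_n)\in\mathbb B_f^{cnc}(\mathcal H)$ and $T'=(T_1',\dots,T_n')\in\mathbb B_f^{cnc}(\mathcal H')$, where $\mathcal H,\mathcal H'$ are Hilbert spaces. Then $T$ and $T'$ are unitarily equivalent if and only if their characteristic functions $\Theta_{f,T}$ and $\Theta_{f,T'}$ coincide.
   Context: Words and series. $\mathbb F_n^+$ is the free semigroup of words in the letters $1,\dots,n$, with empty word $\varnothing$; $|\alpha|$ is the length of $\alpha$. For an $n$-tuple $Y=(Y_1,\dots,Y_n)$ of elements of a unital algebra, $Y_\alpha:=Y_{i_1}\cdots Y_{i_k}$ if $\alpha=i_1\cdots i_k$, and $Y_\varnothing:=1$. Power series are formal power series $\psi=\sum_\alpha a_\alpha Z_\alpha$ with complex coefficients in noncommuting indeterminates $Z_1,\dots,Z_n$. For $Y\in B(\mathcal H)^n$ put $\psi(Y):=\sum_{k\ge0}\sum_{|\alpha|=k}a_\alpha Y_\alpha$ (series over $k$); $\mathcal C_\psi(\mathcal H)$ (resp. $\mathcal C_\psi^{SOT}(\mathcal H)$) is the set of $Y$ for which this converges in norm (resp. in the strong operator topology, SOT). $\mathcal C_\psi^{rad}(\mathcal H)$ is the set of $Y$ for which there is $\delta\in(0,1)$ with $rY\in\mathcal C_\psi(\mathcal H)$ for $r\in(\delta,1)$ and $\text{SOT-}\lim_{r\to1}\psi(rY)$ exists; then $\psi(Y)$ denotes this limit. For an $n$-tuple $f=(f_1,\dots,f_n)$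 of power series these conditions are required for every $f_i$; $f(Y)=(f_1(Y),\dots,f_n(Y))$ is also regarded as a row operator $\mathcal H^{(n)}\to\mathcal H$, where $\mathcal H^{(n)}$ is the direct sum of $n$ copies of $\mathcal H$. $[B(\mathcal H)^n]_r:=\{X\in B(\mathcal H)^n:\|\sum_iX_iX_i^*\|^{1/2}<r\}$. A free holomorphic function on $[B(\mathcal H)^n]_\gamma$ is (the evaluation map of) a power series with $\limsup_k(\sum_{|\alpha|=k}|a_\alpha|^2)^{1/2k}\le1/\gamma$. Model property. $\mathbb H^2(f)$ denotes the Hilbert space with orthonormal basis $\{f_\alpha\}_{\alpha\in\mathbb F_n^+}$ ($f_\varnothing=1$), whose elements are the series $\sum_\alpha c_\alpha f_\alpha$, $\sum|c_\alpha|^2<\infty$. $f$ has the model property ($f\in\mathcal M$) if one of the following holds. ($\mathcal A$) $f$ is an $n$-tuple of noncommutative polynomials and there is an $n$-tuple $q$ of polynomials with $f\circ q=q\circ f=\mathrm{id}$. ($\mathcal S$) $f(0)=0$, each $f_i$ has nonzero radius of convergence, the matrix of linear coefficients of $f$ is invertible ($\det J_f(0)\ne0$; then elements of $\mathbb H^2(f)$ are formal power series), $Z_1,\dots,Z_n\in\mathbb H^2(f)$, each $M_{Z_i}\psi:=Z_i\psi$ is a bounded operator on $\mathbb H^2(f)$, and $M_{f_j}=f_j(M_{Z_1},\dots,M_{Z_n})$, where $M_{f_j}\psi:=f_j\psi$ and $(M_{Z_1},\dots,M_{Z_n})$ is in $\mathcal C_f^{SOT}(\mathbb H^2(f))$ or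 $\mathcal C_f^{rad}(\mathbb H^2(f))$. ($\mathcal F$) for some $\gamma>0$, $f$ is an $n$-tuple of free holomorphic functions on $[B(\mathcal H)^n]_\gamma$ ($\mathcal H$ infinite dimensional) with range in $[B(\mathcal H)^n]_1$, there is no nonzero free holomorphic $G$ on $[B(\mathcal H)^n]_1$ with $G\circ f=0$ (then $\mathbb H^2(f)=\{G\circ f: G=\sum c_\alpha Z_\alpha,\ \sum|c_\alpha|^2<\infty\}$), the coordinate functions lie in $\mathbb H^2(f)$, and the boundedness of $M_{Z_i}$ and $M_{f_j}=f_j(M_{Z_1},\dots,M_{Z_n})$ hold as in ($\mathcal S$). The universal model of $\mathbb B_f$ is $M_Z=(M_{Z_1},\dots,M_{Z_n})$. Writing $Z_i=\sum_\alpha a_\alpha^{(i)}f_\alpha$ in $\mathbb H^2(f)$, the inverse of $f$ under composition is $g=(g_1,\dots,g_n)$, $g_i:=\sum_\alpha a^{(i)}_\alpha Z_\alpha$ (so $g\circ f=\mathrm{id}$). Domain. $\mathbb B_f(\mathcal H)$ is the set of $X\in B(\mathcal H)^n$ with $X\in\mathcal C_f^{SOT}(\mathcal H)$ or $X\in\mathcal C_f^{rad}(\mathcal H)$, $\|f(X)\|\le1$ and $g(f(X))=X$, meaning that either $X_i=\sum_k\sum_{|\alpha|=k}a_\alpha^{(i)}[f(X)]_\alpha$ (SOT convergence) for all $i$, or $X_i=\text{SOT-}\lim_{r\to1}\sum_k\sum_{|\alpha|=k}a_\alpha^{(i)}r^{|\alpha|}[f(X)]_\alpha$ for all $i$. $T\in\mathbb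 B_f(\mathcal H)$ is completely non-coisometric (c.n.c.) if no nonzero $h\in\mathcal H$ satisfies $\langle\Phi_{f,T}^m(I)h,h\rangle=\|h\|^2$ for all $m\ge1$, where $\Phi_{f,T}(Y):=\sum_if_i(T)Yf_i(T)^*$. $\mathbb B_f^{cnc}(\mathcal H)$ is the set of c.n.c. elements of $\mathbb B_f(\mathcal H)$. Class $\mathcal M^b$. With $f_i=\sum_\alpha b_\alpha^{(i)}Z_\alpha$, $f\in\mathcal M^b$ means $f\in\mathcal M$ and either $M_Z\in\mathcal C_f^{SOT}(\mathbb H^2(f))$ and $\sup_m\|\sum_{|\alpha|\le m}b^{(i)}_\alpha(M_Z)_\alpha\|<\infty$ for all $i$, or $M_Z\in\mathcal C_f^{rad}(\mathbb H^2(f))$ and $\sup_{r\in[0,1)}\|\sum_k\sum_{|\alpha|=k}b^{(i)}_\alpha r^{|\alpha|}(M_Z)_\alpha\|<\infty$ for all $i$. Characteristic function. For $T\in\mathbb B_f(\mathcal H)$: $\Delta_{f,T}:=(I_{\mathcal H}-\sum_if_i(T)f_i(T)^* )^{1/2}$, $\Delta_{f,T^*}:=(I_{\mathcal H^{(n)}}-f(T)^*f(T))^{1/2}$, $\mathcal D_{f,T}:=\overline{\Delta_{f,T}\mathcal H}$, $\mathcal D_{f,T^*}:=\overline{\Delta_{f,T^*}\mathcal H^{(n)}}$. $\Lambda_i$ is right multiplication by $f_i$ on $\mathbb H^2(f)$ ($\Lambda_if_\alpha=f_\alpha f_i$). $\Theta_{f,T}:\mathbb H^2(f)\otimes\mathcal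 D_{f,T^*}\to\mathbb H^2(f)\otimes\mathcal D_{f,T}$ is the contraction with formal Fourier representation $$-I\otimes f(T)+(I\otimes\Delta_{f,T})\Big(I-\sum_i\Lambda_i\otimes f_i(T)^*\Big)^{-1}[\Lambda_1\otimes I_{\mathcal H},\dots,\Lambda_n\otimes I_{\mathcal H}](I\otimes\Delta_{f,T^*}),$$ i.e. the SOT-limit as $r\uparrow1$ of the operators obtained by replacing each $\Lambda_i$ by $r\Lambda_i$. It is multi-analytic: $\Theta_{f,T}(M_{Z_i}\otimes I)=(M_{Z_i}\otimes I)\Theta_{f,T}$. Coincidence. Two operators $\Phi:\mathbb H^2(f)\otimes\mathcal K_1\to\mathbb H^2(f)\otimes\mathcal K_2$ and $\Phi':\mathbb H^2(f)\otimes\mathcal K_1'\to\mathbb H^2(f)\otimes\mathcal K_2'$ that are multi-analytic with respect to $M_{Z_1},\dots,M_{Z_n}$ coincide if there are unitary operators $\tau_j:\mathcal K_j\to\mathcal K_j'$, $j=1,2$, with $\Phi'(I\otimes\tau_1)=(I\otimes\tau_2)\Phi$. *)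

(* Defs.v *)
From HB Require Import structures.
From mathcomp Require Import all_boot all_order all_algebra.
From mathcomp Require Import finmap.
From mathcomp Require Import all_classical all_reals ereal topology normedtype sequences.
From mathcomp Require Import esum exp numfun complex.
From mathcomp Require Import ring lra.

Set Implicit Arguments.
Unset Strict Implicit.
Unset Printing Implicit Defensive.

Import Order.TTheory GRing.Theory Num.Theory.
Import numFieldNormedType.Exports.

Local Open Scope classical_set_scope.
Local Open Scope ring_scope.

HB.mixin Record isHilbert (R : realType) V & CompleteNormedModule R[i] V := {
  dot : V -> V -> R[i];
  dotPl : forall a u v w, dot (a *: u + v) w = a * dot u w + dot v w;
  dotC : forall u v, dot u v = (dot v u)^*;
  dotE : forall u, dot u u = `|u| ^+ 2 }.

#[short(type="hilbertType")]
HB.structure Definition Hilbert (R : realType) :=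
  {V of CompleteNormedModule R[i] V & isHilbert R V}.

(* Cauchy-Schwarz and the triangle inequality for an inner product on an
   arbitrary (not necessarily finite-dimensional) space. *)
Section inner_product.
Variables (C : numClosedFieldType) (U : lmodType C) (form : {dot U for Num.conj}).

Lemma dot_CauchySchwarz u v :
  `|form u v| <= sqrtC (form u u) * sqrtC (form v v).
Proof.
rewrite -sqrtCM ?nnegrE ?dnorm_ge0// -(sqrCK (normr_ge0 _)).
rewrite ler_sqrtC ?nnegrE ?exprn_ge0 ?mulr_ge0 ?dnorm_ge0//.
have [->|v0] := eqVneq v 0.
  by rewrite !linear0r normr0 expr0n mulr0.
have vv : 0 < form v v by rewrite dnorm_gt0.
pose a := form u v / form v v.
have ou : form (u - a *: v) v = 0.
  by rewrite linearBl/= linearZl_LR/= divfK ?subrr// gt_eqF.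
have H := @hnormDd _ _ _ _ form (u - a *: v) (a *: v).
rewrite subrK in H.
have {}H : form u u = form (u - a *: v) (u - a *: v) + form (a *: v) (a *: v).
  by apply: H; rewrite linearZr_LR/= ou mulr0.
rewrite H mulrDl dnormZ -mulrA /a normrM normfV (ger0_norm (ltW vv)).
rewrite exprMn -mulrA exprVn -expr2 mulVf ?mulr1 ?expf_neq0 ?gt_eqF//.
by rewrite lerDr mulr_ge0 ?dnorm_ge0.
Qed.

Lemma dot_triangle u v :
  sqrtC (form (u + v) (u + v)) <= sqrtC (form u u) + sqrtC (form v v).
Proof.
have n0 w : 0 <= sqrtC (form w w) by rewrite sqrtC_ge0 dnorm_ge0.
rewrite -(ler_pXn2r (_ : (0 < 2)%N)) ?nnegrE ?addr_ge0//.
rewrite sqrtCK sqrrD !sqrtCK dnormD [leRHS]addrAC lerD2l.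
have -> : form u v + (form u v)^* = 'Re (form u v) *+ 2.
  by rewrite -mulr_natr ReE divfK ?pnatr_eq0.
rewrite lerMn2r/=.
exact: le_trans (leif_Re_Creal _) (dot_CauchySchwarz _ _).
Qed.

End inner_product.

Section signed_sum.
Variables (R : realType) (I : choiceType).
Implicit Types u v a b : I -> R.

Local Notation asummable u := (summable [set: I] (EFin \o u)).

Definition rsum u : R :=
  fine (esum [set: I] (EFin \o u)^\+ - esum [set: I] (EFin \o u)^\-)%E.

Lemma asummable_le u b :
  (forall i, `|u i| <= b i) -> asummable b -> asummable u.
Proof.
move=> ub; apply: le_lt_trans; apply: le_esum => i _ /=.
by rewrite lee_fin (le_trans (ub i))// ler_norm.
Qed.

Lemma asummableD u v : asummable u -> asummable v -> asummable (u \+ v).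
Proof.
move=> su sv; have := summableD su sv.
by congr summable; apply/funext => i /=; rewrite EFinD.
Qed.

Lemma esum_fin a : (forall i, 0 <= a i) -> asummable a ->
  \esum_(i in [set: I]) (a i)%:E \is a fin_num.
Proof.
move=> a0 sa; rewrite (@eq_esum _ _ _ _ (fun i => `|(EFin \o a) i|%E)).
  by rewrite -summableE.
by move=> i _ /=; rewrite ger0_norm.
Qed.

Lemma rsumB a b : (forall i, 0 <= a i) -> (forall i, 0 <= b i) ->
    asummable a -> asummable b ->
  rsum (a \- b) = fine (\esum_(i in [set: I]) (a i)%:E) -
                  fine (\esum_(i in [set: I]) (b i)%:E).
Proof.
move=> a0 b0 sa sb; rewrite -fineB ?esum_fin//; congr fine.
have <- := @esumB _ _ _ (EFin \o a) (EFin \o b) sa sb _ _; last 2 first.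
- by move=> i _; rewrite lee_fin.
- by move=> i _; rewrite lee_fin.
by congr (esum _ _^\+ - esum _ _^\-)%E; apply/funext => i /=; rewrite EFinB.
Qed.

Lemma rsum_ge0E a : (forall i, 0 <= a i) -> asummable a ->
  rsum a = fine (\esum_(i in [set: I]) (a i)%:E).
Proof.
move=> a0 sa.
have s0 : asummable (fun=> 0 : R).
  by apply: asummable_le sa => i; rewrite normr0.
have := rsumB a0 (fun=> lexx 0) sa s0.
rewrite (_ : a \- _ = a); last by apply/funext => i /=; rewrite subr0.
by move=> ->; rewrite [X in _ - fine X]esum1// subr0.
Qed.

Let pos u i := Num.max (u i) 0.
Let neg u i := Num.max (- u i) 0.

Let posnegE u : u = pos u \- neg u.
Proof.
apply/funext => i; rewrite /pos /neg /=.
have [u0|u0] := leP (u i) 0.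
  by rewrite max_l ?oppr_ge0// sub0r opprK.
by rewrite max_r ?oppr_le0 ?ltW// subr0.
Qed.

Let pos_ge0 u i : 0 <= pos u i.
Proof. by rewrite le_max lexx orbT. Qed.

Let neg_ge0 u i : 0 <= neg u i.
Proof. by rewrite le_max lexx orbT. Qed.

Let spos u : asummable u -> asummable (pos u).
Proof.
apply: le_lt_trans; apply: le_esum => i _ /=.
by rewrite lee_fin (ger0_norm (pos_ge0 u i)) ge_max ler_norm normr_ge0.
Qed.

Let sneg u : asummable u -> asummable (neg u).
Proof.
apply: le_lt_trans; apply: le_esum => i _ /=.
by rewrite lee_fin (ger0_norm (neg_ge0 u i)) ge_max ler_normr lexx orbT normr_ge0.
Qed.

Let esumDR a b : (forall i, 0 <= a i) -> (forall i, 0 <= b i) ->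
    asummable a -> asummable b ->
  fine (\esum_(i in [set: I]) (a i + b i)%:E) =
  fine (\esum_(i in [set: I]) (a i)%:E) + fine (\esum_(i in [set: I]) (b i)%:E).
Proof.
move=> a0 b0 sa sb; rewrite -fineD ?esum_fin// -esumD.
- by congr fine; apply: eq_esum => i _; rewrite EFinD.
- by move=> i _; rewrite lee_fin.
- by move=> i _; rewrite lee_fin.
Qed.

Lemma rsumD u v : asummable u -> asummable v ->
  rsum (u \+ v) = rsum u + rsum v.
Proof.
move=> su sv.
have -> : u \+ v = (pos u \+ pos v) \- (neg u \+ neg v).
  rewrite [in LHS](posnegE u) [in LHS](posnegE v); apply/funext => i /=.
  by rewrite addrACA opprD.
rewrite rsumB; last 4 first.
- by move=> i; rewrite addr_ge0.
- by move=> i; rewrite addr_ge0.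
- by apply: asummableD; exact: spos.
- by apply: asummableD; exact: sneg.
have -> : rsum u = rsum (pos u \- neg u) by rewrite -posnegE.
have -> : rsum v = rsum (pos v \- neg v) by rewrite -posnegE.
have [pu nu] := (spos su, sneg su); have [pv nv] := (spos sv, sneg sv).
rewrite !rsumB// (esumDR _ _ pu pv)// (esumDR _ _ nu nv)//.
by rewrite addrACA opprD.
Qed.

Lemma rsumN u : asummable u -> rsum (fun i => - u i) = - rsum u.
Proof.
move=> su.
have sN : asummable (fun i => - u i).
  by move: su; apply: le_lt_trans; apply: le_esum => i _ /=; rewrite normrN.
apply/eqP; rewrite -addr_eq0 -rsumD//.
rewrite (_ : _ \+ _ = fun=> 0); last by apply/funext => i /=; rewrite addNr.
by rewrite rsum_ge0E ?esum1// /summable esum1 ?ltry// => i _ /=; rewrite normr0.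
Qed.

Lemma esumZ c a : 0 <= c -> (forall i, 0 <= a i) ->
  (\esum_(i in [set: I]) (c * a i)%:E = c%:E * \esum_(i in [set: I]) (a i)%:E)%E.
Proof.
move=> c0 a0.
have le d b : 0 <= d -> (forall i, 0 <= b i) ->
    (\esum_(i in [set: I]) (d * b i)%:E <= d%:E * \esum_(i in [set: I]) (b i)%:E)%E.
  move=> d0 b0; apply: ge_ereal_sup => _ [X [fX _]] <-.
  under eq_fsbigr do rewrite EFinM.
  rewrite -ge0_mule_fsumr; last by move=> i; rewrite lee_fin.
  by apply: lee_wpmul2l; rewrite ?lee_fin//; apply: esum_ge; exists X.
apply/eqP; rewrite eq_le le//=.
have [->|c1] := eqVneq c 0.
  by rewrite mul0e esum_ge0// => i _; rewrite mul0r.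
have cp : 0 < c by rewrite lt_def c1.
rewrite -lee_pdivlMl//.
have := le c^-1 (fun i => c * a i).
rewrite invr_ge0 => /(_ c0 (fun i => mulr_ge0 c0 (a0 i))).
apply: le_trans; apply: le_esum => i _.
by rewrite mulrA mulVf// mul1r.
Qed.


Lemma asummableZ c u : asummable u -> asummable (fun i => c * u i).
Proof.
move=> su; rewrite /summable /=.
under eq_esum do rewrite normrM.
by rewrite esumZ// lte_mul_pinfty ?lee_fin.
Qed.

Lemma rsumZ c u : asummable u -> rsum (fun i => c * u i) = c * rsum u.
Proof.
move=> su.
wlog c0 : c / 0 <= c.
  move=> wl; have [/wl//|c0] := leP 0 c.
  rewrite -[c]opprK mulNr -wl ?oppr_ge0 1?ltW// -rsumN; last exact: asummableZ.
  by congr rsum; apply/funext => i; rewrite !mulNr.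
have [sp sn] := (spos su, sneg su).
rewrite (_ : (fun i => c * u i) = (fun i => c * pos u i) \- (fun i => c * neg u i)).
  rewrite rsumB; last 4 first.
  - by move=> i; rewrite mulr_ge0.
  - by move=> i; rewrite mulr_ge0.
  - exact: asummableZ.
  - exact: asummableZ.
  have -> : rsum u = rsum (pos u \- neg u) by rewrite -posnegE.
  rewrite rsumB// !esumZ// !fineM ?esum_fin//.
  by rewrite mulrBr.
by rewrite [in LHS](posnegE u); apply/funext => i /=; rewrite mulrBr.
Qed.

End signed_sum.

Section hilbert_theory.
Variables (R : realType) (H : hilbertType R).

Lemma dot_bilinear :
  bilinear_for ( *%R : R[i] -> R[i] -> R[i]) (Num.conj \; *%R) (@dot R H).
Proof.
split=> w => [a u v|a u v]; first exact: dotPl.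
by rewrite dotC dotPl rmorphD rmorphM/= -!dotC.
Qed.

HB.instance Definition _ :=
  bilinear_isBilinear.Build R[i] H H R[i] _ _ (@dot R H) dot_bilinear.

Lemma dot_hermitian (u v : H) :
  dot u v = (-1) ^+ false * Num.conj (dot v u).
Proof. by rewrite expr0 mul1r dotC. Qed.

HB.instance Definition _ :=
  isHermitianSesquilinear.Build R[i] H false _ (@dot R H) dot_hermitian.

Lemma dot_gt0 (u : H) : u != 0 -> 0 < dot u u.
Proof. by move=> u0; rewrite dotE exprn_gt0// normr_gt0. Qed.

HB.instance Definition _ := isDotProduct.Build R[i] H (@dot R H) dot_gt0.

End hilbert_theory.

(* The norm of a complex normed space, as an element of R rather than of R[i] *)
Section real_norm.
Variables (R : realType) (V : normedModType R[i]).
Implicit Types u v : V.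

Definition nrm v : R := complex.Re `|v|.

Lemma nrmE v : `|v| = (nrm v)%:C%C.
Proof. by rewrite /nrm RRe_real// ger0_real. Qed.

Lemma nrm_ge0 v : 0 <= nrm v.
Proof. by rewrite -lecR -nrmE; exact: normr_ge0. Qed.

Lemma nrm0 : nrm (0 : V) = 0.
Proof. by rewrite /nrm normr0. Qed.

Lemma nrmD u v : nrm (u + v) <= nrm u + nrm v.
Proof. by rewrite -lecR rmorphD/= -!nrmE ler_normD. Qed.

Lemma nrmZ (a : R[i]) v : nrm (a *: v) = ComplexField.Normc.normc a * nrm v.
Proof. by apply: complexI; rewrite rmorphM/= -!nrmE normrZ. Qed.

Lemma nrmN v : nrm (- v) = nrm v.
Proof. by rewrite /nrm normrN. Qed.

End real_norm.

Lemma normc_Re_le (R : realType) (z : R[i]) :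
  `|complex.Re z| <= ComplexField.Normc.normc z.
Proof. by rewrite -lecR; exact: normc_ge_Re. Qed.

Lemma normc_Im_le (R : realType) (z : R[i]) :
  `|complex.Im z| <= ComplexField.Normc.normc z.
Proof. 
case: z => a b /=; rewrite -(sqrtr_sqr b) ler_sqrt ?lerDr ?sqr_ge0//.
by rewrite addr_ge0 ?sqr_ge0.
Qed.

Lemma dot_nrm_le (R : realType) (H : hilbertType R) (u v : H) :
  ComplexField.Normc.normc (dot u v) <= nrm u * nrm v.
Proof.
rewrite -lecR rmorphM/= -!nrmE.
have /= := @dot_CauchySchwarz _ _ (@dot R H) u v.
by rewrite !dotE !sqrCK.
Qed.

Section l2_space.
Variables (R : realType) (I : choiceType) (K : hilbertType R).

Definition sumsq (x : I -> K) : \bar R :=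
  (\esum_(i in [set: I]) (nrm (x i) ^+ 2)%:E)%E.

Definition l2_pred : {pred I -> K} := fun x => (sumsq x < +oo)%E.

Lemma sumsq_ge0 x : (0 <= sumsq x)%E.
Proof. by apply: esum_ge0 => i _; rewrite lee_fin sqr_ge0. Qed.

Lemma l2_submod_closed : submod_closed l2_pred.
Proof.
split=> [|a x y].
  rewrite /l2_pred unfold_in /sumsq esum1 ?ltry// => i _.
  by rewrite nrm0 expr0n.
rewrite !unfold_in => sx sy.
pose c := ComplexField.Normc.normc a.
apply: (@le_lt_trans _ _ (\esum_(i in [set: I])
   ((2 * c ^+ 2 * nrm (x i) ^+ 2)%:E + (2 * nrm (y i) ^+ 2)%:E)))%E.
  apply: le_esum => i _; rewrite -EFinD lee_fin.
  have := nrmD (a *: x i) (y i); rewrite nrmZ -/c.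
  have := nrm_ge0 (x i); have := nrm_ge0 (y i).
  have c0 : 0 <= c by rewrite /c; case: (a) => ? ?; exact: sqrtr_ge0.
  move: (nrm (x i)) (nrm (y i)) => r s s0 r0 h.
  apply: (@le_trans _ _ ((c * r + s) ^+ 2)).
    by rewrite ler_pXn2r ?nnegrE ?addr_ge0 ?mulr_ge0 ?nrm_ge0.
  have := sqr_ge0 (c * r - s).
  move=> sq0; rewrite -subr_ge0 (_ : _ - _ = (c * r - s) ^+ 2)//; ring.
have c2 : 0 <= 2 * c ^+ 2 by rewrite pmulr_rge0 ?sqr_ge0.
have sq (w : K) : 0 <= nrm w ^+ 2 by rewrite sqr_ge0.
rewrite esumD; last 2 first.
- by move=> i _; rewrite lee_fin; exact: mulr_ge0.
- by move=> i _; rewrite lee_fin pmulr_rge0.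
rewrite !esumZ//.
by rewrite lte_add_pinfty// lte_mul_pinfty ?lee_fin.
Qed.

HB.instance Definition _ := GRing.isSubmodClosed.Build _ _ l2_pred
  l2_submod_closed.

Record l2 := L2 { l2fun :> I -> K; l2P : l2fun \in l2_pred }.

HB.instance Definition _ := [isSub for l2fun].
HB.instance Definition _ := [Choice of l2 by <:].
HB.instance Definition _ := [SubChoice_isSubLmodule of l2 by <:].

Implicit Types x y z : l2.

Lemma l2E x y : (forall i, x i = y i) -> x = y.
Proof. by move=> xy; apply: val_inj; apply/funext. Qed.

Lemma l2_sum x : (sumsq x < +oo)%E.
Proof. exact: l2P. Qed.

Lemma l2_addE x y i : (x + y) i = x i + y i. Proof. by []. Qed.
Lemma l2_scaleE (a : R[i]) x i : (a *: x) i = a *: x i. Proof. by []. Qed.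
Lemma l2_oppE x i : (- x) i = - x i. Proof. by []. Qed.
Lemma l2_zeroE i : (0 : l2) i = 0. Proof. by []. Qed.

Local Notation Re := complex.Re.
Local Notation Im := complex.Im.

Definition l2dot x y : R[i] :=
  (rsum (fun i => Re (dot (x i) (y i))) +i*
   rsum (fun i => Im (dot (x i) (y i))))%C.

Lemma l2_nrm_summable x : summable [set: I] (fun i => (nrm (x i) ^+ 2)%:E).
Proof.
rewrite /summable; apply: le_lt_trans (l2_sum x); apply: le_esum => i _ /=.
by rewrite lee_fin ger0_norm ?sqr_ge0.
Qed.

Let dot_bound x y i :
  ComplexField.Normc.normc (dot (x i) (y i)) <= nrm (x i) ^+ 2 + nrm (y i) ^+ 2.
Proof.
apply: le_trans (dot_nrm_le _ _) _.
have := nrm_ge0 (x i); have := nrm_ge0 (y i).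
move: (nrm (x i)) (nrm (y i)) => r s; nra.
Qed.

Let sumD x y :
  summable [set: I] (EFin \o ((fun i => nrm (x i) ^+ 2) \+ (fun i => nrm (y i) ^+ 2))).
Proof. by apply: asummableD; exact: l2_nrm_summable. Qed.

Lemma l2_Re_summable x y :
  summable [set: I] (EFin \o (fun i => Re (dot (x i) (y i)))).
Proof.
apply: asummable_le (sumD x y) => i /=.
exact: le_trans (normc_Re_le _) (dot_bound _ _ _).
Qed.

Lemma l2_Im_summable x y :
  summable [set: I] (EFin \o (fun i => Im (dot (x i) (y i)))).
Proof.
apply: asummable_le (sumD x y) => i /=.
exact: le_trans (normc_Im_le _) (dot_bound _ _ _).
Qed.

Let ReP (p q : R) (a b : R[i]) :
  Re ((p +i* q)%C * a + b) = p * Re a + (- q * Im a + Re b).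
Proof. by case: a => a1 a2; case: b => b1 b2 /=; rewrite mulNr addrA. Qed.

Let ImP (p q : R) (a b : R[i]) :
  Im ((p +i* q)%C * a + b) = p * Im a + (q * Re a + Im b).
Proof. by case: a => a1 a2; case: b => b1 b2 /=; rewrite addrA. Qed.

Lemma l2dotPl (a : R[i]) x y z :
  l2dot (a *: x + y) z = a * l2dot x z + l2dot y z.
Proof.
case: a => p q.
have S1 := l2_Re_summable; have S2 := l2_Im_summable.
rewrite [LHS]/l2dot.
have -> : (fun i => Re (dot (((p +i* q)%C *: x + y) i) (z i))) =
  (fun i => p * Re (dot (x i) (z i))) \+
  ((fun i => - q * Im (dot (x i) (z i))) \+ (fun i => Re (dot (y i) (z i)))).
  by apply/funext => i; rewrite [RHS]/= l2_addE l2_scaleE dotPl ReP.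
have -> : (fun i => Im (dot (((p +i* q)%C *: x + y) i) (z i))) =
  (fun i => p * Im (dot (x i) (z i))) \+
  ((fun i => q * Re (dot (x i) (z i))) \+ (fun i => Im (dot (y i) (z i)))).
  by apply/funext => i; rewrite [RHS]/= l2_addE l2_scaleE dotPl ImP.
have ZR c := asummableZ c (S1 x z); have ZI c := asummableZ c (S2 x z).
rewrite (rsumD (ZR p) (asummableD (ZI (- q)) (S1 y z))).
rewrite (rsumD (ZI (- q)) (S1 y z)).
rewrite (rsumD (ZI p) (asummableD (ZR q) (S2 y z))) (rsumD (ZR q) (S2 y z)).
rewrite !(rsumZ _ (S1 x z)) !(rsumZ _ (S2 x z)).
by apply/eqP; rewrite eq_complex ReP ImP /= !eqxx.
Qed.

Lemma l2dotC x y : l2dot x y = Num.conj (l2dot y x).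
Proof.
rewrite /l2dot [RHS]/=; congr (_ +i* _)%C.
  by congr rsum; apply/funext => i; rewrite dotC; case: (dot _ _).
rewrite -rsumN; last exact: l2_Im_summable.
by congr rsum; apply/funext => i; rewrite dotC; case: (dot _ _).
Qed.

Lemma l2dotE x : l2dot x x = (fine (sumsq x))%:C%C.
Proof.
have e i : dot (x i) (x i) = (nrm (x i) ^+ 2)%:C%C.
  by rewrite dotE nrmE rmorphXn.
rewrite /l2dot; congr (_ +i* _)%C.
  rewrite -rsum_ge0E; first by congr rsum; apply/funext => i; rewrite e.
    by move=> i; rewrite sqr_ge0.
  exact: l2_nrm_summable.
rewrite (_ : (fun _ => _) = (fun=> 0 * 0)); last first.
  by apply/funext => i; rewrite e mul0r.
rewrite rsumZ ?mul0r// /summable esum1 ?ltry// => i _ /=.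
by rewrite normr0.
Qed.

Lemma sumsq_eq0 x : sumsq x = 0%E -> x = 0.
Proof.
move=> x0; apply: l2E => i; apply/eqP; rewrite l2_zeroE -normr_eq0 nrmE.
have : ((nrm (x i) ^+ 2)%:E <= sumsq x)%E.
  apply: esum_ge; exists [set i]; first by split.
  by rewrite fsbig_set1.
rewrite x0 lee_fin => h.
have : nrm (x i) ^+ 2 == 0 by rewrite eq_le h sqr_ge0.
by rewrite sqrf_eq0 => /eqP ->.
Qed.

Lemma sumsq_fin x : sumsq x \is a fin_num.
Proof. by rewrite ge0_fin_numE ?sumsq_ge0 ?l2_sum. Qed.

Lemma l2dot_gt0 x : x != 0 -> 0 < l2dot x x.
Proof.
move=> x0; rewrite l2dotE -[0]/(0%:C%C) ltcR lt_def fine_ge0 ?sumsq_ge0// andbT.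
apply: contra x0 => /eqP h; apply/eqP; apply: sumsq_eq0.
by rewrite -(fineK (sumsq_fin x)) h.
Qed.

Lemma l2dot_bilinear :
  bilinear_for ( *%R : R[i] -> R[i] -> R[i]) (Num.conj \; *%R) l2dot.
Proof.
split=> w => [a u v|a u v]; first exact: l2dotPl.
by rewrite l2dotC l2dotPl rmorphD rmorphM/= -!l2dotC.
Qed.

HB.instance Definition _ :=
  bilinear_isBilinear.Build R[i] l2 l2 R[i] _ _ l2dot l2dot_bilinear.

Lemma l2dot_hermitian x y :
  l2dot x y = (-1) ^+ false * Num.conj (l2dot y x).
Proof. by rewrite expr0 mul1r l2dotC. Qed.

HB.instance Definition _ :=
  isHermitianSesquilinear.Build R[i] l2 false _ l2dot l2dot_hermitian.
HB.instance Definition _ := isDotProduct.Build R[i] l2 l2dot l2dot_gt0.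

Definition l2norm x : R[i] := sqrtC (l2dot x x).

Lemma l2norm_triangle x y : l2norm (x + y) <= l2norm x + l2norm y.
Proof. exact: dot_triangle. Qed.

Lemma l2normZ (a : R[i]) x : l2norm (a *: x) = `|a| * l2norm x.
Proof.
rewrite /l2norm (dnormZ l2dot) sqrtCM ?nnegrE ?exprn_ge0 ?dnorm_ge0//.
by rewrite sqrCK.
Qed.

Lemma l2norm_eq0 x : l2norm x = 0 -> x = 0.
Proof. by move/eqP; rewrite sqrt_dnorm_eq0 => /eqP. Qed.

HB.instance Definition _ := @Lmodule_isNormed.Build R[i] l2 l2norm
  l2norm_triangle l2normZ l2norm_eq0.

Lemma l2_normE x : `|x| = sqrtC (l2dot x x).
Proof. by []. Qed.

Lemma l2_nrmE x : (nrm x ^+ 2)%:E = sumsq x.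
Proof.
rewrite -(fineK (sumsq_fin x)); congr (_%:E); apply: complexI.
by rewrite -l2dotE rmorphXn/= -nrmE l2_normE sqrtCK.
Qed.

Lemma sumsq_coord (x : I -> K) i : ((nrm (x i) ^+ 2)%:E <= sumsq x)%E.
Proof.
by apply: esum_ge; exists [set i]; [split|rewrite fsbig_set1].
Qed.

Lemma l2_coord_le x i : nrm (x i) <= nrm x.
Proof.
have := sumsq_coord x i; rewrite -l2_nrmE lee_fin.
by rewrite ler_pXn2r ?nnegrE ?nrm_ge0.
Qed.

Lemma Rcomplex_gt0 (e : R[i]) : 0 < e -> exists2 r : R, 0 < r & e = r%:C%C.
Proof.
move=> e0; exists (Re e); last by rewrite RRe_real ?gtr0_real.
by rewrite -ltcR RRe_real ?gtr0_real.
Qed.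

Lemma nrm_ball (V : normedModType R[i]) (u v : V) (e : R) :
  ball u e%:C%C v <-> nrm (u - v) < e.
Proof. by rewrite -ball_normE /ball_/= nrmE ltcR. Qed.

Lemma l2_complete (F : set_system l2) : ProperFilter F -> cauchy F -> cvg F.
Proof.
move=> FF cF.
have near_ball (e : R) : 0 < e -> exists x, F [set z | nrm (x - z) < e].
  move=> e0; have /cauchyP/(_ e%:C%C) := cF.
  rewrite -[0]/(0%:C%C) ltcR => /(_ e0)[x Fx]; exists x.
  by apply: filterS Fx => z /nrm_ball.
have coordcvg i : exists v : K, forall d, 0 < d -> F [set z | nrm (v - z i) < d].
  have : cauchy ((fun x : l2 => x i) @ F).
    apply/cauchyP => e /Rcomplex_gt0[r r0 ->].
    have [x Fx] := near_ball _ r0; exists (x i).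
    change (F [set z : l2 | ball (x i) r%:C%C (z i)]).
    apply: filterS Fx => z /= xz; apply/nrm_ball.
    by apply: le_lt_trans xz; have := l2_coord_le (x - z) i; rewrite l2_addE.
  move=> /cauchy_cvgP /cvg_ex [v Fv]; exists v => d d0.
  move/cvg_ballP : Fv => /(_ d%:C%C); rewrite -[0]/(0%:C%C) ltcR => /(_ d0).
  by apply: filterS => z /nrm_ball.
have [y yP] := choice coordcvg.
have key (e : R) x : 0 < e -> F [set z | nrm (x - z) < e] ->
    (sumsq (y - (x : I -> K))%R <= (4 * e ^+ 2)%:E)%E.
  move=> e0 Fx; apply: ge_ereal_sup => _ [J [fJ _]] <-.
  rewrite fsbig_finite//=.
  set A := fset_set J.
  pose m := size (finmap.enum_fset A).
  have [d d0 de] : exists2 d, 0 < d & e = m.+1%:R * d.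
    by exists (e / m.+1%:R); [rewrite divr_gt0|rewrite mulrC divfK].
  have := @filter_bigI _ _ A (fun i => [set z : l2 | nrm (y i - z i) < d]) F _
    (fun i _ => yP i d d0).
  move=> /(_ _)/(filterI Fx)/filter_ex [z [/= xz yz]].
  have zx : \sum_(i <- A) nrm ((z - x) i) ^+ 2 <= e ^+ 2.
    apply: (@le_trans _ _ (nrm (z - x) ^+ 2)).
      rewrite -lee_fin l2_nrmE -sumEFin; apply: esum_ge.
      by exists J; [split|rewrite fsbig_finite].
    rewrite ler_pXn2r ?nnegrE ?nrm_ge0 ?ltW//.
    by rewrite -nrmN opprB.
  rewrite sumEFin lee_fin.
  apply: (@le_trans _ _
      (\sum_(i <- A) (2 * d ^+ 2 + 2 * nrm ((z - x) i) ^+ 2))).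
    rewrite big_seq [leRHS]big_seq; apply: ler_sum => i iA.
    have /= h1 := yz i iA.
    have /= h2 : nrm ((y - (x : I -> K)) i) <= nrm (y i - z i) + nrm ((z - x) i).
      rewrite [leLHS](_ : _ = nrm ((y i - z i) + (z - x) i)); first exact: nrmD.
      by congr nrm; rewrite l2_addE l2_oppE addrA subrK.
    have h3 := nrm_ge0 (y i - z i); have h4 := nrm_ge0 ((z - x) i).
    apply: (@le_trans _ _ ((d + nrm ((z - x) i)) ^+ 2)).
      rewrite ler_pXn2r ?nnegrE ?nrm_ge0 ?addr_ge0 ?(ltW d0)//.
      by apply: le_trans h2 _; rewrite lerD2r ltW.
    have := sqr_ge0 (d - nrm ((z - x) i)); nra.
  rewrite big_split/= big_const_seq count_predT iter_addr_0 -/m -mulr_sumr -mulrnAr.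
  have md : 2 * (d ^+ 2 *+ m) <= 2 * e ^+ 2.
    have hm : m%:R <= m.+1%:R ^+ 2 :> R.
      rewrite -natrX ler_nat (leq_trans (leqnSn m))// expnS expn1.
      by rewrite -[leqLHS]muln1 leq_mul.
    have := ler_wpM2r (sqr_ge0 d) hm; rewrite de exprMn -[X in 2 * X]mulr_natl.
    by rewrite ler_pM2l.
  rewrite (_ : 4 * e ^+ 2 = 2 * e ^+ 2 + 2 * e ^+ 2); last by ring.
  by apply: lerD => //; rewrite ler_pM2l.
have y2 : y \in l2_pred.
  have [x Fx] := near_ball _ (ltr01 : 0 < 1 :> R).
  rewrite -[y](subrK (x : I -> K)); apply: rpredD; last exact: l2P.
  by rewrite unfold_in (le_lt_trans (key _ _ ltr01 Fx))// ltry.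
pose Y := L2 y2.
apply/cvg_ex; exists Y; apply/cvg_ballP => e /Rcomplex_gt0[r r0 ->].
have r4 : 0 < r / 4 by rewrite divr_gt0.
have [x Fx] := near_ball _ r4.
apply: filterS (Fx) => z /= xz; apply/nrm_ball.
have Yx : nrm (Y - x) <= r / 2.
  have := key _ _ r4 Fx.
  rewrite -[sumsq _]/(sumsq (Y - x)) -l2_nrmE lee_fin => h.
  have := nrm_ge0 (Y - x); move: (nrm (Y - x)) h => t h t0.
  by rewrite leNgt; apply/negP => rt; nra.
rewrite -(subrK x Y) -addrA (le_lt_trans (nrmD _ _))//.
by move: Yx xz; lra.
Qed.

HB.instance Definition _ := Uniform_isComplete.Build l2 l2_complete.

Lemma l2dot_norm x : l2dot x x = `|x| ^+ 2.
Proof. by rewrite l2_normE sqrtCK. Qed.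

HB.instance Definition _ := isHilbert.Build R l2 l2dotPl l2dotC l2dot_norm.

End l2_space.


(* The one-dimensional Hilbert space C; an alias, because R^o is already taken
   as a complete space for R : realType *)
Definition Cspace (R : realType) : Type := R[i].
HB.instance Definition _ (R : realType) := NormedModule.copy (Cspace R) (R[i]^o).

Section complex_hilbert.
Variable R : realType.
Local Notation C := (Cspace R).

Lemma nrm_complexE (z : C) : nrm z = ComplexField.Normc.normc (z : R[i]).
Proof. by apply: complexI; rewrite -nrmE. Qed.

Lemma complex_complete (F : set_system C) : ProperFilter F -> cauchy F -> cvg F.
Proof.
move=> FF cF.
have near_ball (e : R) : 0 < e -> exists x, F [set z | nrm (x - z) < e].
  move=> e0; have /cauchyP/(_ e%:C%C) := cF.
  rewrite -[0]/(0%:C%C) ltcR => /(_ e0)[x Fx]; exists x.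
  by apply: filterS Fx => z /nrm_ball.
have coord (p : R[i] -> R) : (forall x y : C, `|p x - p y| <= nrm (x - y)) ->
    exists v : R, forall d, 0 < d -> F [set z | `|v - p z| < d].
  move=> pE.
  have : cauchy ((p : C -> R^o) @ F).
    apply/cauchyP => e e0.
    have [x Fx] := near_ball _ e0; exists (p x).
    change (F [set z : C | ball (p x : R^o) e (p z)]).
    apply: filterS Fx => z /= xz; rewrite -ball_normE /ball_/=.
    by apply: le_lt_trans xz; exact: pE.
  move=> /cauchy_cvgP /cvg_ex [v Fv]; exists v => d d0.
  move/cvg_ballP : Fv => /(_ d d0).
  by apply: filterS => z; rewrite -ball_normE.
have [a aP] := coord (@complex.Re R)
  (fun x y => ltac:(by rewrite -raddfB nrm_complexE; exact: normc_Re_le)).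
have [b bP] := coord (@complex.Im R)
  (fun x y => ltac:(by rewrite -raddfB nrm_complexE; exact: normc_Im_le)).
apply/cvg_ex; exists ((a +i* b)%C : C).
apply/cvg_ballP => e /Rcomplex_gt0[r r0 ->].
have r2 : 0 < r / 2 by rewrite divr_gt0.
apply: filterS (filterI (aP _ r2) (bP _ r2)) => z [/= az bz].
apply/nrm_ball; rewrite nrm_complexE.
case: z az bz => c d /= az bz.
rewrite -(@ltr_pXn2r _ 2) ?nnegrE ?sqrtr_ge0 ?ltW// sqr_sqrtr ?addr_ge0 ?sqr_ge0//.
rewrite -(real_normK (num_real (a - c))) -(real_normK (num_real (b - d))).
have := normr_ge0 (a - c); have := normr_ge0 (b - d).
move: `|a - c| `|b - d| az bz => p q; nra.
Qed.

HB.instance Definition _ := Uniform_isComplete.Build C complex_complete.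

Definition cdot (x y : C) : R[i] := (x : R[i]) * (y : R[i])^*.

Lemma cdotPl (a : R[i]) (u v w : C) :
  cdot (a *: u + v) w = a * cdot u w + cdot v w.
Proof. by rewrite /cdot mulrDl mulrA. Qed.

Lemma cdotC (u v : C) : cdot u v = (cdot v u)^*.
Proof. by rewrite /cdot rmorphM/= conjCK mulrC. Qed.

Lemma cdotE (u : C) : cdot u u = `|u| ^+ 2.
Proof. by rewrite /cdot -normCK. Qed.

HB.instance Definition _ := isHilbert.Build R C cdotPl cdotC cdotE.

End complex_hilbert.

(* B(H, K): everywhere defined linear maps of finite operator norm *)
Section operators.
Variable R : realType.
Implicit Types H K : hilbertType R.

Definition opnorm H K (A : H -> K) : \bar R :=
  ereal_sup [set (nrm (A x))%:E | x in [set x : H | nrm x <= 1]].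

Definition bounded_op H K (A : H -> K) : Prop :=
  linear A /\ (opnorm A < +oo)%E.

Definition adjoint H K (A : H -> K) : K -> H :=
  get [set B : K -> H |
       bounded_op B /\ forall x y, dot (A x) y = dot x (B y)].

Definition positive_op H (A : H -> H) : Prop := forall x, 0 <= dot (A x) x.

Definition sqrt_op H (A : H -> H) : H -> H :=
  get [set P : H -> H | [/\ bounded_op P, positive_op P & P \o P = A]].

Definition inv_op H (A : H -> H) : H -> H :=
  get [set B : H -> H | [/\ bounded_op B, A \o B = id & B \o A = id]].

(* U is a unitary operator from the closed subspace D of H onto the closed
   subspace E of K; its values outside D are irrelevant *)
Definition unitary_on H K (D : set H) (E : set K) (U : H -> K) : Prop :=
  [/\ forall (a : R[i]) x y, D x -> D y -> U (a *: x + y) = a *: U x + U y,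
      forall x y, D x -> D y -> dot (U x) (U y) = dot x y &
      U @` D = E].

Definition infinite_dim H : Prop :=
  ~ exists s : seq H, forall h,
      exists c : 'I_(size s) -> R[i], h = \sum_i c i *: s`_i.

End operators.

(* Tensor products: l2 I K is the Hilbert space tensor product of l2 I with K,
   the family x standing for \sum_i e_i (x) x_i, and l2 'I_n K is the direct
   sum of n copies of K *)
Section tensor.
Variable R : realType.
Implicit Types K L : hilbertType R.

Definition to_l2 (I : choiceType) K (x : I -> K) : l2 I K := insubd 0 x.

(* I (x) A *)
Definition l2map (I : choiceType) K L (A : K -> L) (x : l2 I K) : l2 I L :=
  to_l2 (fun i => A (x i)).

(* Lambda_i (x) A, where Lambda_i maps the basis vector indexed by the word b
   to the one indexed by b followed by the letter i *)
Definition Lambda n (i : 'I_n) K L (A : K -> L) (x : l2 (seq 'I_n) K) :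
    l2 (seq 'I_n) L :=
  to_l2 (fun a => let b := take (size a).-1 a in
                  if a == rcons b i then A (x b) else 0).

Definition rowop n K (Y : 'I_n -> K -> K) (x : l2 'I_n K) : K :=
  \sum_i Y i (x i).

End tensor.

(* Formal power series in n noncommuting indeterminates *)
Section series.
Variables (R : realType) (n : nat).

Definition fps : Type := seq 'I_n -> R[i].
Implicit Types (p q : fps) (f : 'I_n -> fps).

Definition fone : fps := fun a => (a == [::])%:R.

Definition fvar (i : 'I_n) : fps := fun a => (a == [:: i])%:R.

Definition fmul p q : fps :=
  fun a => \sum_(k < (size a).+1) p (take k a) * q (drop k a).

Definition fprod f (a : seq 'I_n) : fps := foldr (fun i => fmul (f i)) fone a.

(* \sum_b p_b f_b. The sum over b is finite, as it must be in \sum_(_ \in _),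
   when p is a polynomial, and also when f has no constant terms, since then
   f_b only has terms of length at least |b| *)
Definition fcomp p f : fps :=
  fun a => \sum_(b \in [set: seq 'I_n]) p b * fprod f b a.

Definition is_poly p : Prop :=
  exists N, forall a : seq 'I_n, (N < size a)%N -> p a = 0.

(* For c > 0: p is a free holomorphic function on the ball of radius c *)
Definition free_hol (c : R) p : Prop :=
  (limn_esup (fun k =>
     ((\sum_(a : k.-tuple 'I_n) ComplexField.Normc.normc (p a) ^+ 2)
        `^ ((2 * k)%:R^-1))%:E) <= (c^-1)%:E)%E.

Variable H : hilbertType R.
Implicit Types Y X : 'I_n -> H -> H.

Definition wprod Y (a : seq 'I_n) : H -> H :=
  foldr (fun i A => Y i \o A) id a.

Definition psum p Y (m : nat) (h : H) : H :=
  \sum_(k < m.+1) \sum_(a : k.-tuple 'I_n) p a *: wprod Y a h.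

(* The sum of the series p(Y). It is computed pointwise: this is the sum both
   for SOT and for norm convergence *)
Definition fval p Y (h : H) : H := limn (fun m => psum p Y m h).

Definition norm_conv p Y : Prop :=
  exists2 L : H -> H, bounded_op L &
    opnorm (fun h => psum p Y m h - L h) @[m --> \oo] --> 0%E.

Definition sot_conv p Y : Prop :=
  exists2 L : H -> H, bounded_op L &
    forall h, psum p Y m h @[m --> \oo] --> L h.

Definition rscale (r : R) Y : 'I_n -> H -> H := fun i h => r%:C%C *: Y i h.

Definition radval p Y (h : H) : H :=
  lim (fval p (rscale r Y) h @[r --> (1 : R)^'-]).

Definition rad_conv p Y : Prop :=
  (exists2 d : R, 0 < d < 1 & forall r, d < r < 1 -> norm_conv p (rscale r Y))
  /\
  exists2 L : H -> H, bounded_op L &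
    forall h, fval p (rscale r Y) h @[r --> (1 : R)^'-] --> L h.

Definition sot_dom f Y : Prop := forall i, sot_conv (f i) Y.

Definition rad_dom f Y : Prop := forall i, rad_conv (f i) Y.

(* f(Y), for Y in sot_dom f or in rad_dom f; by Abel's theorem the two
   definitions agree on the intersection *)
Definition feval f Y : 'I_n -> H -> H := fun i =>
  if `[< sot_dom f Y >] then fval (f i) Y else radval (f i) Y.

Definition op_ball (c : R) X : Prop :=
  (forall i, bounded_op (X i)) /\
  (sqrte (opnorm (fun h => \sum_i X i (adjoint (X i) h))%R) < c%:E)%E.

End series.
Arguments fone {R n}.
Arguments fvar {R n}.

(* H^2(f) in coordinates: the family c stands for \sum_a c_a f_a *)
Notation H2 R n := (l2 (seq 'I_n) (Cspace R)).

Section model.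
Variables (R : realType) (n : nat).
Variables (f g : 'I_n -> fps R n) (MZ : 'I_n -> H2 R n -> H2 R n).

Definition in_H2 (p : fps R n) : Prop :=
  (sumsq (p : seq 'I_n -> Cspace R) < +oo)%E.

(* Each of the three properties says that f has the model property in the
   corresponding way, that g is the inverse of f, and that MZ is the universal
   model (M_{Z_1}, ..., M_{Z_n}) acting on H^2(f); g and MZ are determined
   by f. *)

(* Here the finite sums \sum_a c_a f_a are all the polynomials, and they are
   dense in H^2(f) *)
Definition model_A : Prop :=
  [/\ forall i, is_poly (f i),
      forall i, is_poly (g i),
      forall i, fcomp (f i) g = fvar i /\ fcomp (g i) f = fvar i,
      forall i, bounded_op (MZ i) &
      forall i (c : H2 R n), is_poly c ->
        is_poly (MZ i c) /\ fcomp (MZ i c) f = fmul (fvar i) (fcomp c f)].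

Definition model_S : Prop :=
  [/\ forall i, f i [::] = 0,
      forall i, exists2 c : R, 0 < c & free_hol c (f i),
      \det (\matrix_(i, j) f i [:: j]) != 0,
      forall i, in_H2 (g i) /\ fcomp (g i) f = fvar i &
   [/\ forall i, bounded_op (MZ i),
      forall i (c : H2 R n), fcomp (MZ i c) f = fmul (fvar i) (fcomp c f),
      sot_dom f MZ \/ rad_dom f MZ &
      forall j (c : H2 R n),
        fcomp (feval f MZ j c) f = fmul (f j) (fcomp c f)]].

(* The elements of H^2(f) are here the functions X |-> c(f(X)) *)
Definition model_F : Prop :=
  exists2 r : R, 0 < r &
  [/\ forall i, free_hol r (f i),
      forall i, in_H2 (g i),
      forall i, bounded_op (MZ i),
      sot_dom f MZ \/ rad_dom f MZ &
  forall K : hilbertType R, infinite_dim K ->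
  let F (X : 'I_n -> K -> K) := fun i => fval (f i) X in
  [/\ forall X, op_ball r X -> op_ball 1 (F X),
      forall G, free_hol 1 G -> (forall X, op_ball r X -> fval G (F X) = 0) ->
        G = 0,
      forall i X, op_ball r X -> fval (g i) (F X) = X i,
      forall i (c : H2 R n) X, op_ball r X ->
        fval (MZ i c) (F X) = X i \o fval c (F X) &
      forall j (c : H2 R n) X, op_ball r X ->
        fval (feval f MZ j c) (F X) = F X j \o fval c (F X)]].

Definition class_M : Prop := [\/ model_A, model_S | model_F].

Definition class_Mb : Prop :=
  class_M /\
  ((sot_dom f MZ /\
    forall i, (ereal_sup (range (fun m => opnorm (psum (f i) MZ m))) < +oo)%E)
   \/
   (rad_dom f MZ /\
    forall i, (ereal_sup [set opnorm (fval (f i) (rscale r MZ)) |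
                          r in [set r : R | (0 <= r < 1)%R]] < +oo)%E)).

End model.

Section domain.
Variables (R : realType) (n : nat) (f g : 'I_n -> fps R n).
Variable H : hilbertType R.
Implicit Types X Y T : 'I_n -> H -> H.

(* g(Y) = X *)
Definition inverse_at Y X : Prop :=
  (forall i h, psum (g i) Y m h @[m --> \oo] --> X i h) \/
  (forall i h, fval (g i) (rscale r Y) h @[r --> (1 : R)^'-] --> X i h).

Definition Bf X : Prop :=
  [/\ forall i, bounded_op (X i),
      sot_dom f X \/ rad_dom f X,
      (opnorm (rowop (feval f X)) <= 1)%E &
      inverse_at (feval f X) X].

Definition Phi T (A : H -> H) : H -> H :=
  fun h => \sum_i feval f T i (A (adjoint (feval f T i) h)).

Definition cnc T : Prop :=
  forall h, (forall m, (0 < m)%N -> dot (iter m (Phi T) id h) h = `|h| ^+ 2) ->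
    h = 0.

Definition Bf_cnc T : Prop := Bf T /\ cnc T.

Definition Delta T : H -> H :=
  sqrt_op (fun h => h - \sum_i feval f T i (adjoint (feval f T i) h)).

Definition Delta_star T : l2 'I_n H -> l2 'I_n H :=
  let F := rowop (feval f T) in sqrt_op (fun x => x - adjoint F (F x)).

Definition defect T : set H := closure (range (Delta T)).

Definition defect_star T : set (l2 'I_n H) := closure (range (Delta_star T)).

(* The formula for the characteristic function with r Lambda_i in place of
   Lambda_i. The row [Lambda_1 (x) I, ..., Lambda_n (x) I] is
   \sum_i Lambda_i (x) P_i, with P_i the i-th coordinate projection of l2 'I_n H
   onto H. *)
Definition charfun_r T (r : R) (x : l2 (seq 'I_n) (l2 'I_n H)) :
    l2 (seq 'I_n) H :=
  - l2map (rowop (feval f T)) x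
  + l2map (Delta T)
      (inv_op
        (fun y => y - \sum_i r%:C%C *: Lambda i (adjoint (feval f T i)) y)
        (\sum_i r%:C%C *:
           Lambda i (fun v : l2 'I_n H => v i) (l2map (Delta_star T) x))).

(* Theta_{f,T}, as the restriction of this map to the families with all terms
   in defect_star T; its values are families with all terms in defect T *)
Definition charfun T (x : l2 (seq 'I_n) (l2 'I_n H)) : l2 (seq 'I_n) H :=
  lim (charfun_r T r x @[r --> (1 : R)^'-]).

End domain.

Section equivalence.
Variables (R : realType) (n : nat).

Definition unitarily_equivalent (H H' : hilbertType R)
    (T : 'I_n -> H -> H) (T' : 'I_n -> H' -> H') : Prop :=
  exists2 U : H -> H', unitary_on setT setT U &
    forall i, U \o T i = T' i \o U.

(* Coincidence of Phi : H^2(f) (x) D1 -> H^2(f) (x) D2 with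
   Phi' : H^2(f) (x) D1' -> H^2(f) (x) D2', where the D's are closed subspaces *)
Definition coincide (K1 K2 K1' K2' : hilbertType R)
    (D1 : set K1) (D2 : set K2) (D1' : set K1') (D2' : set K2')
    (Phi : l2 (seq 'I_n) K1 -> l2 (seq 'I_n) K2)
    (Phi' : l2 (seq 'I_n) K1' -> l2 (seq 'I_n) K2') : Prop :=
  exists (tau1 : K1 -> K1') (tau2 : K2 -> K2'),
  [/\ unitary_on D1 D1' tau1, unitary_on D2 D2' tau2 &
      forall x : l2 (seq 'I_n) K1, (forall a, D1 (x a)) ->
        Phi' (l2map tau1 x) = l2map tau2 (Phi x)].

End equivalence.

(* Main.v *)
Require Import Defs.
From mathcomp Require Import all_boot all_order all_algebra.
From mathcomp Require Import all_classical all_reals ereal topology normedtype sequences.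
From mathcomp Require Import esum numfun complex.
From mathcomp Require Import ring lra.

(** Write F = f(T) and F' = f(T') for the rows obtained by evaluating f. As
   T = g(F) and T' = g(F'), the tuples T and T' are unitarily equivalent if and
   only if F and F' are, so the theorem is about completely non-coisometric row
   contractions: they are classified by their characteristic functions.

   If U intertwines F and F', it intertwines their adjoints, the defect
   operators Delta and Delta_* (square roots are limits of polynomials,
   [sqrt_op_intertwine]) and the resolvents, hence the characteristic functions
   ([unitary_coincide]).

   Conversely, let Theta have the Fourier coefficients theta_a, which are
   Theta's coordinates at the tensors e_[] (x) v ([char_op_single]). Their
   adjoints determine the Gram matrix of the vectors F_a Delta d, where a is a
   word and d is in the defect space: this is the identity
   K K^* = I - Theta Theta^* for the Poisson kernel K h = sum_a e_a (x) Delta F_a^* h,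
   which in coordinates is a recursion on the first letters of two words
   ([poisson_gram_cons], [poisson_gram_cons_nil], [poisson_gram_nil]). The
   hypothesis on T says that K is injective, that is, that the vectors
   F_a Delta d are total ([poisson_total]). If Theta and Theta' coincide, then
   F_a Delta d and F'_a Delta' (tau2 d) are total families with the same Gram
   matrix, so a unitary operator U exchanges them ([gram_unitary]). Since F_i
   maps F_a Delta d to F_ia Delta d, it follows that U intertwines F and F'
   ([coincide_unitary]).

   The passage from F to T is a limit of power series. The coefficients of g are
   square-summable, so the homogeneous parts of g at a row contraction are
   bounded and the series converges at rF for r < 1; Abel's theorem ([abel])
   makes every solution of g(F) = T a radial limit, and U preserves radial
   limits ([inverse_at_unitary]).

   The supporting operator theory rests on one minimization argument
   ([riesz_graph]), which gives the adjoints as well as U, and on the iteration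
   Y -> (B + Y^2)/2 for the square root of I - B ([sqrt_op_iter]). *)

Set Implicit Arguments.
Unset Strict Implicit.
Unset Printing Implicit Defensive.

Import Order.TTheory GRing.Theory Num.Theory.
Import numFieldNormedType.Exports.

Local Open Scope classical_set_scope.
Local Open Scope ring_scope.

(** * Norms, inner products and limits *)

Lemma Re_rmul (R : rcfType) (t : R) (a : R[i]) :
  complex.Re (t%:C%C * a) = t * complex.Re a.
Proof. by case: a => x y /=; rewrite mul0r subr0. Qed.

Lemma conjc_real_complex (R : rcfType) (t : R) : (t%:C%C)^* = t%:C%C.
Proof. by apply/eqP; rewrite eq_complex/= oppr0 !eqxx. Qed.

Lemma ge0_Re (R : rcfType) (a : R[i]) : 0 <= a -> 0 <= complex.Re a.
Proof. by case: a => x y; rewrite lecE => /andP[_]. Qed.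

Section norm_convergence.
Variables (R : realType) (V : normedModType R[i]).
Implicit Types (u v l : V).

Lemma nrm_eq0 v : nrm v = 0 -> v = 0.
Proof. by move=> v0; apply/eqP; rewrite -normr_eq0 nrmE v0. Qed.

Lemma nrm_distC u v : nrm (u - v) = nrm (v - u).
Proof. by rewrite -nrmN opprB. Qed.

Lemma nrmZr (r : R) v : nrm (r%:C%C *: v) = `|r| * nrm v.
Proof.
rewrite nrmZ; congr (_ * _).
by rewrite /ComplexField.Normc.normc /= expr0n addr0 sqrtr_sqr.
Qed.

Lemma nrm_sum (J : Type) (s : seq J) (P : pred J) (w : J -> V) :
  nrm (\sum_(j <- s | P j) w j) <= \sum_(j <- s | P j) nrm (w j).
Proof.
apply: (big_ind2 (fun x y => nrm x <= y)) => //; first by rewrite nrm0.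
by move=> x1 x2 y1 y2 h1 h2; apply: le_trans (nrmD _ _) (lerD h1 h2).
Qed.

Lemma cvg_nrmP T (F : set_system T) {FF : Filter F} (f : T -> V) l :
  f @ F --> l <-> forall e : R, 0 < e -> \forall t \near F, nrm (l - f t) < e.
Proof.
split=> [/cvg_ballP fl e e0|fl].
  have := fl e%:C%C; rewrite -[0]/(0%:C%C) ltcR => /(_ e0).
  by apply: filterS => t /nrm_ball.
apply/cvg_ballP => e /Rcomplex_gt0[r r0 ->].
by apply: filterS (fl r r0) => t lt; apply/nrm_ball.
Qed.

Lemma cvg_nrm_seqP (u : nat -> V) l :
  u @ \oo --> l <->
  forall e : R, 0 < e -> exists N, forall m, (N <= m)%N -> nrm (l - u m) < e.
Proof.
split=> [/cvg_nrmP h e /h [N _ hN]|h]; first by exists N => m; apply: hN.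
by apply/cvg_nrmP => e /h [N hN]; exists N.
Qed.

Lemma nrm_cvg_le T (F : set_system T) {FF : ProperFilter F} (f : T -> V) l
    (c : R) :
  f @ F --> l -> (\forall t \near F, nrm (f t) <= c) -> nrm l <= c.
Proof.
move=> /cvg_nrmP fl fc; apply/ler_addgt0Pl => e e0.
have [t [h1 h2]] := filter_ex (filterI (fl _ e0) fc).
rewrite -(subrK (f t) l); apply: le_trans (nrmD _ _) _.
exact: lerD (ltW h1) h2.
Qed.

Lemma limit_unique T (F : set_system T) {FF : ProperFilter F} (f : T -> V) (a b : V) :
  f @ F --> a -> f @ F --> b -> a = b.
Proof. by move=> fa fb; exact: (cvg_unique (@norm_hausdorff _ V) fa fb). Qed.

End norm_convergence.

Lemma limit_unique_real (R : realType) T (F : set_system T)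
    {FF : ProperFilter F} (f : T -> R) (a b : R) :
  f @ F --> a -> f @ F --> b -> a = b.
Proof. by move=> fa fb; exact: (cvg_unique (@norm_hausdorff _ R) fa fb). Qed.

Section hilbert_basics.
Variables (R : realType) (H : hilbertType R).
Implicit Types (u v w : H) (a b : R[i]).

Lemma dotDl u v w : dot (u + v) w = dot u w + dot v w.
Proof. by rewrite -[u]scale1r dotPl mul1r scale1r. Qed.

Lemma dot0l w : dot 0 w = 0.
Proof. by apply: (addrI (dot 0 w)); rewrite -dotDl !addr0. Qed.

Lemma dotZl a u w : dot (a *: u) w = a * dot u w.
Proof. by rewrite -[a *: u]addr0 dotPl dot0l addr0. Qed.

Lemma dotNl u w : dot (- u) w = - dot u w.
Proof. by rewrite -scaleN1r dotZl mulN1r. Qed.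

Lemma dotBl u v w : dot (u - v) w = dot u w - dot v w.
Proof. by rewrite dotDl dotNl. Qed.

Lemma dot_suml J (s : seq J) (P : pred J) (x : J -> H) w :
  dot (\sum_(j <- s | P j) x j) w = \sum_(j <- s | P j) dot (x j) w.
Proof. by apply: (big_morph (dot^~ w)) => [u v|]; rewrite ?dotDl ?dot0l. Qed.

Lemma dotDr u v w : dot w (u + v) = dot w u + dot w v.
Proof. by rewrite dotC dotDl rmorphD/= -!dotC. Qed.

Lemma dot0r w : dot w 0 = 0.
Proof. by rewrite dotC dot0l rmorph0. Qed.

Lemma dotZr a u w : dot w (a *: u) = a^* * dot w u.
Proof. by rewrite dotC dotZl rmorphM/= -dotC. Qed.

Lemma dotNr u w : dot w (- u) = - dot w u.
Proof. by rewrite dotC dotNl rmorphN/= -dotC. Qed.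

Lemma dotBr u v w : dot w (u - v) = dot w u - dot w v.
Proof. by rewrite dotDr dotNr. Qed.

Lemma dot_sumr J (s : seq J) (P : pred J) (x : J -> H) w :
  dot w (\sum_(j <- s | P j) x j) = \sum_(j <- s | P j) dot w (x j).
Proof. by apply: (big_morph (dot w)) => [u v|]; rewrite ?dotDr ?dot0r. Qed.

Lemma dot_nrm u : dot u u = (nrm u ^+ 2)%:C%C.
Proof. by rewrite dotE nrmE rmorphXn. Qed.

Lemma dot_real u v : dot u v = dot v u -> dot u v = (complex.Re (dot u v))%:C%C.
Proof.
move=> uv; have := dotC u v; rewrite -uv; case: (dot u v) => x y [e].
by apply/eqP; rewrite eq_complex /= eqxx /=; apply/eqP; lra.
Qed.

Lemma nrm_sqrD u v :
  nrm (u + v) ^+ 2 = nrm u ^+ 2 + nrm v ^+ 2 + 2 * complex.Re (dot u v).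
Proof.
apply: complexI; rewrite -dot_nrm dotDl !dotDr !rmorphD/= -!dot_nrm (dotC v u).
case: (dot u v) => x y; case: (dot u u) => a b; case: (dot v v) => c d.
by apply/eqP; rewrite eq_complex/=; apply/andP; split; apply/eqP; ring.
Qed.

Lemma dot_eq0 u : (forall v, dot u v = 0) -> u = 0.
Proof.
move=> /(_ u); rewrite dot_nrm => -[/eqP].
by rewrite sqrf_eq0 => /eqP /nrm_eq0.
Qed.

Lemma dot_inj u v : (forall w, dot u w = dot v w) -> u = v.
Proof.
by move=> uv; apply/eqP; rewrite -subr_eq0; apply/eqP/dot_eq0 => w;
   rewrite dotBl uv subrr.
Qed.

Lemma dot_injr u v : (forall w, dot w u = dot w v) -> u = v.
Proof. by move=> uv; apply: dot_inj => w; rewrite dotC uv -dotC. Qed.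

(** The imaginary part of a complex linear functional at v is, up to sign, its
   real part at i v. *)
Lemma Re_dot_inj (phi : H -> R[i]) u :
  (forall a v, phi (a *: v) = a * phi v) ->
  (forall v, complex.Re (phi v) = complex.Re (dot v u)) ->
  forall v, phi v = dot v u.
Proof.
move=> phiZ E v; apply/eqP; rewrite eq_complex E eqxx/=.
have := E ('i%C *: v); rewrite phiZ dotZl.
by case: (phi v) (dot v u) => a b [c d] /=; rewrite !mul0r !mul1r !sub0r => /oppr_inj ->.
Qed.

Lemma nrm_le_dot (c : R) u :
  0 <= c -> (forall v, complex.Re (dot u v) <= c * nrm v) -> nrm u <= c.
Proof.
move=> c0 /(_ u); rewrite dot_nrm/= => h.
have := nrm_ge0 u; move: (nrm u) h => t h t0.
by rewrite leNgt; apply/negP => ct; nra.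
Qed.

Lemma normr_Re_dot u v : `|complex.Re (dot u v)| <= nrm u * nrm v.
Proof. exact: le_trans (normc_Re_le _) (dot_nrm_le _ _). Qed.

Lemma Re_dot_le u v : complex.Re (dot u v) <= nrm u * nrm v.
Proof. exact: le_trans (ler_norm _) (normr_Re_dot _ _). Qed.

Lemma cvg_Re_dot T (F : set_system T) {FF : Filter F} (f : T -> H) u w :
  f @ F --> u -> complex.Re (dot (f t) w) @[t --> F] --> complex.Re (dot u w).
Proof.
move=> /cvg_nrmP fu; apply/cvgrPdist_lt => e e0.
have d0 : 0 < e / (nrm w + 1) by rewrite divr_gt0// ltr_wpDl// nrm_ge0.
apply: filterS (fu _ d0) => t; rewrite ltr_pdivlMr ?ltr_wpDl ?nrm_ge0// => h.
rewrite -raddfB -dotBl; apply: le_lt_trans (normr_Re_dot _ _) (le_lt_trans _ h).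
by rewrite ler_wpM2l ?nrm_ge0// lerDl.
Qed.

Lemma Re_dotC u v : complex.Re (dot u v) = complex.Re (dot v u).
Proof. by rewrite dotC; case: (dot v u). Qed.

(** The form in which completeness is used: comparison with a bounded monotone
   real sequence spares the Cauchy estimates in the minimization below, in the
   square root iteration and in the geometric series. *)
Lemma cvg_dominated_increments (u : nat -> H) (t : nat -> R) (M : R) :
  (forall k, nrm (u k.+1 - u k) <= t k.+1 - t k) -> (forall k, t k <= M) ->
  exists2 l, u @ \oo --> l & nrm (l - u 0%N) <= M - t 0%N.
Proof.
move=> ut tM.
have ut' k m : nrm (u (k + m)%N - u k) <= t (k + m)%N - t k.
  elim: m => [|m IH]; first by rewrite addn0 !subrr nrm0.
  rewrite addnS -(subrKA (u (k + m)%N)) -(subrKA (t (k + m)%N)).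
  by apply: le_trans (nrmD _ _) (lerD (ut _) IH).
have tnd : nondecreasing_seq t.
  apply/nondecreasing_seqP => k; rewrite -subr_ge0.
  exact: le_trans (nrm_ge0 _) (ut k).
have /cvg_ex[s ts] : cvgn t.
  by apply: nondecreasing_is_cvgn => //; exists M => _ [k _ <-].
have st k : t k <= s.
  rewrite -(cvg_lim _ ts)//; apply: nondecreasing_cvgn_le => //.
  by apply/cvg_ex; exists s.
have : cauchy (u @ \oo).
  apply/cauchyP => e /Rcomplex_gt0[r r0 ->].
  have /cvgrPdist_lt/(_ r r0)[N _ hN] := ts.
  exists (u N); exists N => // m /= Nm; apply/nrm_ball; rewrite nrm_distC.
  rewrite -(subnKC Nm); apply: le_lt_trans (ut' _ _) _.
  apply: le_lt_trans (hN N (leqnn N)).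
  by rewrite (le_trans _ (ler_norm _))// lerD2r st.
move=> /cauchy_cvgP /cvg_ex[l ul]; exists l => //.
apply: (@nrm_cvg_le _ _ _ \oo _ (fun k => u k - u 0%N)).
  exact: cvgB ul (cvg_cst _).
apply: nearW => k; apply: le_trans (ut' 0%N k) _.
by rewrite add0n lerD2r.
Qed.

End hilbert_basics.

(** * Bounded operators and the representation theorem *)

Section linear_maps.
Variables (R : realType) (H K : hilbertType R) (A : H -> K).
Hypothesis linA : linear A.

Lemma linD x y : A (x + y) = A x + A y.
Proof. by have := linA 1 x y; rewrite !scale1r. Qed.

Lemma lin0 : A 0 = 0.
Proof. by apply: (addrI (A 0)); rewrite -linD !addr0. Qed.

Lemma linZ a x : A (a *: x) = a *: A x.
Proof. by have := linA a x 0; rewrite !addr0 lin0 addr0. Qed.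

Lemma linN x : A (- x) = - A x.
Proof. by rewrite -scaleN1r linZ scaleN1r. Qed.

Lemma linB x y : A (x - y) = A x - A y.
Proof. by rewrite linD linN. Qed.

Lemma lin_sum J (s : seq J) (P : pred J) (x : J -> H) :
  A (\sum_(j <- s | P j) x j) = \sum_(j <- s | P j) A (x j).
Proof. by apply: (big_morph A) => [u v|]; rewrite ?linD ?lin0. Qed.

Lemma opnorm_leP (c : R) : 0 <= c ->
  (opnorm A <= c%:E)%E <-> forall x, nrm (A x) <= c * nrm x.
Proof.
move=> c0; split=> [Ac x|Ac]; last first.
  apply: ge_ereal_sup => _ [x /= x1 <-]; rewrite lee_fin.
  by rewrite (le_trans (Ac x))// ler_piMr.
have [x0|x0] := eqVneq (nrm x) 0.
  by rewrite x0 (nrm_eq0 x0) lin0 nrm0 mulr0.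
have xp : 0 < nrm x by rewrite lt_def x0 nrm_ge0.
have : ((nrm (A ((nrm x)^-1%:C%C *: x)))%:E <= opnorm A)%E.
  apply: ereal_sup_ubound; exists ((nrm x)^-1%:C%C *: x) => //=.
  by rewrite nrmZr ger0_norm ?invr_ge0 ?(ltW xp)// mulVf.
move=> /le_trans /(_ Ac); rewrite lee_fin linZ nrmZr ger0_norm ?invr_ge0 ?(ltW xp)//.
by rewrite ler_pdivrMl// mulrC.
Qed.

Lemma bounded_lin (c : R) :
  0 <= c -> (forall x, nrm (A x) <= c * nrm x) -> bounded_op A.
Proof.
by move=> c0 /(opnorm_leP c0) Ac; split => //; apply: le_lt_trans Ac (ltry _).
Qed.

End linear_maps.

Lemma linear_sub (R : realType) (H K : hilbertType R) (A B : H -> K) :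
  linear A -> linear B -> linear (fun x => A x - B x).
Proof. by move=> lA lB a x y; rewrite lA lB scalerBr opprD addrACA. Qed.

Section bounded_maps.
Variables (R : realType).
Implicit Types H K L : hilbertType R.

Lemma bounded_opP H K (A : H -> K) : bounded_op A ->
  linear A /\ exists2 c : R, 0 <= c & forall x, nrm (A x) <= c * nrm x.
Proof.
move=> [lA Ab]; split=> //; exists (fine (opnorm A)).
  apply: fine_ge0; apply: ereal_sup_ubound; exists 0; rewrite /= ?nrm0 ?ler01//.
  by rewrite (lin0 lA) nrm0.
have A0 : (0 <= opnorm A)%E.
  apply: ereal_sup_ubound; exists 0; rewrite /= ?nrm0 ?ler01//.
  by rewrite (lin0 lA) nrm0.
apply/(opnorm_leP lA); first exact: fine_ge0.
by rewrite fineK// ge0_fin_numE.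
Qed.

Lemma bounded_comp H K L (A : K -> L) (B : H -> K) :
  bounded_op A -> bounded_op B -> bounded_op (A \o B).
Proof.
move=> /bounded_opP[lA [a a0 Aa]] /bounded_opP[lB [b b0 Bb]].
apply: (@bounded_lin _ _ _ _ _ (a * b)); first 1 last.
- exact: mulr_ge0.
- by move=> x /=; rewrite (le_trans (Aa _))// -mulrA ler_wpM2l.
by move=> c x y /=; rewrite lB lA.
Qed.

Lemma bounded_cvg H K (A : H -> K) T (F : set_system T) {FF : Filter F}
    (u : T -> H) l :
  bounded_op A -> u @ F --> l -> (fun t => A (u t)) @ F --> A l.
Proof.
move=> /bounded_opP[lA [c c0 Ac]] /cvg_nrmP ul; apply/cvg_nrmP => e e0.
have d0 : 0 < e / (c + 1) by rewrite divr_gt0// ltr_wpDl.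
apply: filterS (ul _ d0) => t; rewrite ltr_pdivlMr ?ltr_wpDl// => h.
rewrite -(linB lA); apply: le_lt_trans (Ac _) _; apply: le_lt_trans h.
by rewrite mulrC ler_wpM2l ?nrm_ge0// lerDl.
Qed.

End bounded_maps.

(** First-order condition for a minimum at 0. *)
Lemma quadratic_ge0_linear_term (R : realFieldType) (b c : R) :
  (forall t, 0 <= t ^+ 2 * c + 2 * t * b) -> b = 0.
Proof.
move=> h; apply/eqP; rewrite -sqrf_eq0 eq_le sqr_ge0 andbT.
have cd : c < `|c| + 1 by rewrite (le_lt_trans (ler_norm c))// ltrDl.
have : 0 < `|c| + 1 by rewrite ltr_wpDl.
move: (`|c| + 1) cd => d cd d0.
have := mulr_ge0 (ltW (exprn_gt0 2 d0)) (h (- b / d)).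
have -> : d ^+ 2 * ((- b / d) ^+ 2 * c + 2 * (- b / d) * b) = b ^+ 2 * (c - 2 * d).
  by field; rewrite gt_eqF.
by have := sqr_ge0 b; move: (b ^+ 2) => s; nra.
Qed.

Section riesz.
Variables (R : realType) (H : hilbertType R).

(** The Riesz representation theorem for a functional given by its graph [G]
   on an arbitrary linear subspace: neither single-valuedness nor an extension
   to the closure needs to be established beforehand, because both come out of
   minimizing the quadratic functional |y|^2 - 2 Re s over [G]. By the
   parallelogram law a minimizing sequence converges, and the variation of the
   functional at the limit is the representation formula. *)
Lemma riesz_graph (G : R[i] -> H -> Prop) (M : R) :
  0 <= M -> G 0 0 ->
  (forall a s y t z, G s y -> G t z -> G (a * s + t) (a *: y + z)) ->
  (forall s y, G s y -> complex.Re s <= M * nrm y) ->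
  exists2 z, nrm z <= M & forall s y, G s y -> s = dot y z.
Proof.
move=> M0 G0 Glin GM.
pose E : set R := [set nrm p.2 ^+ 2 - 2 * complex.Re p.1 | p in
  [set p : R[i] * H | G p.1 p.2]].
have Elb : lbound E (- M ^+ 2).
  move=> _ [[s y] /= Gsy <-]; have := GM _ _ Gsy; have := nrm_ge0 y.
  have := sqr_ge0 (nrm y - M).
  by move: (nrm y) (complex.Re s) => r x; nra.
have Einf : has_inf E by split; [exists (nrm (0 : H) ^+ 2 - 2 * 0), (0, 0)|
  exists (- M ^+ 2)].
set m := inf E.
have mE s y : G s y -> m <= nrm y ^+ 2 - 2 * complex.Re s.
  by move=> Gsy; apply: ge_inf; [exists (- M ^+ 2)|exists (s, y)].
have seqE k : exists p : R[i] * H, G p.1 p.2 /\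
    nrm p.2 ^+ 2 - 2 * complex.Re p.1 < m + (2^-1 ^+ k) ^+ 2.
  have e0 : 0 < (2^-1 ^+ k) ^+ 2 :> R by rewrite !exprn_gt0// invr_gt0.
  by have [_ [[s y] /= Gsy <-] ?] := inf_adherent e0 Einf; exists (s, y).
have [p /all_and2 [pG pm]] := choice seqE.
have par k : nrm ((p k.+1).2 - (p k).2) <= 2 * 2^-1 ^+ k.
  have := mE _ _ (Glin 1 _ _ _ _ (pG k.+1) (Glin 1 _ _ _ _ (pG k) G0)).
  have := mE _ _ (Glin (2^-1%:C%C) _ _ _ _ (pG k.+1)
    (Glin (2^-1%:C%C) _ _ _ _ (pG k) G0)).
  rewrite !addr0 -scalerDr nrmZr -mulrDr => mid _.
  have := pm k.+1; have := pm k.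
  have := nrm_sqrD (p k.+1).2 (p k).2.
  have := nrm_sqrD (p k.+1).2 (- (p k).2); rewrite dotNr raddfN nrmN/=.
  move: mid; rewrite ger0_norm ?invr_ge0//.
  have -> : complex.Re (2^-1%:C%C * ((p k.+1).1 + (p k).1)) =
      2^-1 * (complex.Re (p k.+1).1 + complex.Re (p k).1).
    by rewrite Re_rmul raddfD.
  rewrite (exprS 2^-1 k); set q := 2^-1 ^+ k.
  have q0 : 0 < q by rewrite exprn_gt0// invr_gt0.
  set D := nrm (_ - _); set S := nrm (_ + _) => mid e1 e2 h1 h2.
  rewrite -(@ler_pXn2r _ 2) ?nnegrE ?nrm_ge0 ?mulr_ge0 ?(ltW q0)//.
  have q2 : 0 < q ^+ 2 by rewrite exprn_gt0.
  by move: mid e1 e2 h1 h2; rewrite (exprMn _ _ S) !(exprMn _ _ q); lra.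
have [z pz _] : exists2 z, (fun k => (p k).2) @ \oo --> z & _ :=
  @cvg_dominated_increments _ _ _ (fun k => - (4 * 2^-1 ^+ k)) 0
    (fun k => ltac:(apply: le_trans (par k) _; rewrite exprS; lra))
    (fun k => ltac:(rewrite oppr_le0 mulr_ge0// exprn_ge0// invr_ge0//)).
have repr s y : G s y -> complex.Re s = complex.Re (dot y z).
  move=> Gsy; apply/eqP; rewrite eq_sym -subr_eq0; apply/eqP.
  apply: (@quadratic_ge0_linear_term _ _ (nrm y ^+ 2)) => t.
  apply/ler_addgt0Pl => e e0.
  have d0 : 0 < e / 2 / (2 * `|t| * nrm y + 1).
    by rewrite !divr_gt0// ltr_wpDl// !mulr_ge0 ?nrm_ge0.
  have [N hN] := (cvg_nrm_seqP _ _).1 pz _ d0.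
  have m0 : 0 < Num.min 1 (e / 2) by rewrite lt_min ltr01 divr_gt0.
  have /cvgrPdist_lt/(_ _ m0)[N' _ hN'] : 2^-1 ^+ k @[k --> \oo] --> (0 : R).
    by apply: cvg_expr; rewrite ger0_norm ?invr_ge0// invf_lt1// ltr1n.
  pose k := maxn N N'.
  have := hN k (leq_maxl _ _); have := hN' k (leq_maxr _ _) => /=.
  rewrite sub0r normrN ger0_norm ?exprn_ge0 ?invr_ge0//.
  rewrite lt_min => /andP[q1 qe].
  rewrite ltr_pdivlMr ?ltr_wpDl ?mulr_ge0 ?nrm_ge0// => de.
  have {q1 qe} qe : (2^-1 ^+ k) ^+ 2 < e / 2.
    apply: le_lt_trans qe; by rewrite expr2 ler_piMr ?(ltW q1)// exprn_ge0// invr_ge0.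
  have := mE _ _ (Glin t%:C%C _ _ _ _ Gsy (pG k)); have := pm k.
  rewrite nrm_sqrD nrmZr exprMn -normrX (ger0_norm (sqr_ge0 t)) dotZl Re_rmul.
  rewrite raddfD/= Re_rmul.
  have := normr_Re_dot y (z - (p k).2); rewrite dotBr raddfB/=.
  set x := complex.Re (dot y z); set xk := complex.Re (dot y _) => xd.
  have {xd}: `|t * (x - xk)| <= `|t| * nrm y * nrm (z - (p k).2).
    by rewrite normrM -mulrA ler_wpM2l.
  rewrite ler_norml => /andP[+ _].
  move: qe de; rewrite mulrDr mulr1 mulrCA mulrA.
  have := nrm_ge0 (z - (p k).2).
  set D := nrm (z - _) => D0; lra.
have rep s y : G s y -> s = dot y z.
  move=> Gsy; apply/eqP; rewrite eq_complex (repr _ _ Gsy) eqxx/=.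
  have := repr _ _ (Glin 'i%C _ _ _ _ Gsy G0); rewrite !addr0 dotZl.
  case: (s) (dot y z) => a b [c d] /=; rewrite !mul0r !mul1r !sub0r.
  by move/oppr_inj ->.
exists z => //.
suff : nrm z ^+ 2 <= M * nrm z.
  by have := nrm_ge0 z; move: (nrm z) => r r0 h; rewrite leNgt; apply/negP; nra.
apply/ler_addgt0Pl => e e0.
have d0 : 0 < e / (M + nrm z + 1) by rewrite divr_gt0// ltr_wpDl// addr_ge0 ?nrm_ge0.
have [N /(_ N (leqnn N))] := (cvg_nrm_seqP _ _).1 pz _ d0.
rewrite ltr_pdivlMr ?ltr_wpDl ?addr_ge0 ?nrm_ge0// => de.
have := nrmD (p N).2 (z - (p N).2); have := nrmD z ((p N).2 - z).
have := GM _ _ (pG N); rewrite (repr _ _ (pG N)).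
have := Re_dot_le (z - (p N).2) z; rewrite dotBl raddfB/= dot_nrm/=.
rewrite !subrKC (nrm_distC _ z).
have := nrm_ge0 (z - (p N).2); move: de.
move: (nrm (z - _)) (nrm z) (nrm (p N).2) (complex.Re _) => D r s x; nra.
Qed.

End riesz.

(** * Adjoints *)

Section adjoints.
Variable R : realType.
Implicit Types H K L : hilbertType R.

Lemma adjointP H K (A : H -> K) : bounded_op A ->
  bounded_op (adjoint A) /\ forall x y, dot (A x) y = dot x (adjoint A y).
Proof.
move=> /bounded_opP[lA [c c0 Ac]].
suff [B] : exists B : K -> H,
    bounded_op B /\ forall x y, dot (A x) y = dot x (B y).
  move=> BP; exact: (@getPex _ [set B : K -> H |
    bounded_op B /\ forall x y, dot (A x) y = dot x (B y)] (ex_intro _ B BP)).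
have rep y : exists z, nrm z <= c * nrm y /\ forall x, dot (A x) y = dot x z.
  have [||a _ x _ x' -> ->|_ x ->|z zc zE] := @riesz_graph R H
    (fun s x => s = dot (A x) y) (c * nrm y).
  - by rewrite mulr_ge0 ?nrm_ge0.
  - by rewrite (lin0 lA) dot0l.
  - by rewrite lA dotDl dotZl.
  - apply: le_trans (Re_dot_le _ _) _; rewrite mulrAC.
    by rewrite ler_wpM2r ?nrm_ge0.
  - by exists z; split=> // x; apply: zE.
have [B /all_and2[Bc BE]] := choice rep; exists B; split=> //.
apply: (@bounded_lin _ _ _ _ _ c) => // a y z.
by apply: dot_injr => x; rewrite -BE !dotDr !dotZr !BE.
Qed.

Lemma bounded_adjoint H K (A : H -> K) : bounded_op A -> bounded_op (adjoint A).
Proof. by case/adjointP. Qed.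

Lemma dot_adjoint H K (A : H -> K) x y :
  bounded_op A -> dot (A x) y = dot x (adjoint A y).
Proof. by case/adjointP. Qed.

Lemma dot_adjointl H K (A : H -> K) x y :
  bounded_op A -> dot (adjoint A y) x = dot y (A x).
Proof. by move=> bA; rewrite dotC -dot_adjoint// -dotC. Qed.

Lemma adjoint_unique H K (A : H -> K) (B : K -> H) : bounded_op A ->
  (forall x y, dot (A x) y = dot x (B y)) -> adjoint A =1 B.
Proof.
move=> bA AB y; apply: dot_inj => x.
by rewrite dot_adjointl// dotC AB -dotC.
Qed.

Lemma adjointK H K (A : H -> K) : bounded_op A -> adjoint (adjoint A) =1 A.
Proof.
move=> bA; apply: adjoint_unique; first exact: bounded_adjoint.
by move=> x y; rewrite dot_adjointl.
Qed.

Lemma nrm_adjoint_le H K (A : H -> K) (c : R) : bounded_op A -> 0 <= c ->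
  (forall x, nrm (A x) <= c * nrm x) -> forall y, nrm (adjoint A y) <= c * nrm y.
Proof.
move=> bA c0 Ac y; apply: nrm_le_dot => [|x]; first by rewrite mulr_ge0 ?nrm_ge0.
rewrite dot_adjointl//; apply: le_trans (Re_dot_le _ _) _.
by rewrite mulrC mulrAC ler_wpM2r ?nrm_ge0.
Qed.

End adjoints.

(** * Positive square roots *)

Section square_roots.
Variable R : realType.
Implicit Types H K : hilbertType R.

Definition symmetric H (A : H -> H) : Prop := forall x y, dot (A x) y = dot x (A y).

Definition contraction H K (A : H -> K) : Prop :=
  linear A /\ forall x, nrm (A x) <= nrm x.

Lemma contraction_bounded H K (A : H -> K) : contraction A -> bounded_op A.
Proof.
by case=> lA A1; apply: (@bounded_lin _ _ _ _ lA 1) => // x; rewrite mul1r.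
Qed.

(** Over the complex numbers positivity forces symmetry, by polarization. *)
Lemma positive_symmetric H (A : H -> H) :
  linear A -> positive_op A -> symmetric A.
Proof.
move=> lA pA x y; rewrite (dotC x).
have Im0 z : complex.Im (dot (A z) z) = 0.
  by have := pA z; case: (dot (A z) z) => a b; rewrite lecE /= => /andP[/eqP].
have := Im0 (x + y); have := Im0 (x + 'i%C *: y); have := Im0 x; have := Im0 y.
rewrite !(linD lA) (linZ lA) !dotDl !dotDr !dotZl !dotZr.
case: (dot (A x) x) (dot (A y) y) (dot (A x) y) (dot (A y) x) => [a b] [c d] [p q] [s t] /=.
move=> h1 h2 h3 h4; apply/eqP; rewrite eq_complex/=; apply/andP.
by split; apply/eqP; lra.
Qed.

Lemma positive_form_eq0 H (P : H -> H) y :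
  linear P -> positive_op P -> dot (P y) y = 0 -> P y = 0.
Proof.
move=> lP pP Py0; have sP := positive_symmetric lP pP.
apply: nrm_eq0; apply/eqP; rewrite -sqrf_eq0; apply/eqP.
apply: (@quadratic_ge0_linear_term _ _ (complex.Re (dot (P (P y)) (P y)))) => t.
have := ge0_Re (pP (y + t%:C%C *: P y)).
rewrite (linD lP) (linZ lP) !dotDl !dotDr !dotZl !dotZr Py0 (sP (P y) y) dot_nrm.
by rewrite conjc_real_complex !raddfD/= !Re_rmul /=; lra.
Qed.

Section iteration.
Variables (H : hilbertType R) (B : H -> H).

(** The iteration Y -> (B + Y^2)/2, whose fixed points Y satisfy
   (1 - Y)^2 = 1 - B. *)
Fixpoint sqrt_iter k (x : H) : H :=
  if k is k'.+1 then
    (2^-1 : R)%:C%C *: (B x + sqrt_iter k' (sqrt_iter k' x))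
  else 0.

(** The same iteration for the number 1 in place of [B]; it dominates the
   increments of the operator iteration. *)
Fixpoint sqrt_iter1 k : R :=
  if k is k'.+1 then 2^-1 * (1 + sqrt_iter1 k' ^+ 2) else 0.

Lemma sqrt_iter1_itv k : 0 <= sqrt_iter1 k <= 1.
Proof.
elim: k => [|k /andP[h0 h1]] /=; first by rewrite lexx ler01.
have := exprn_ge0 2 h0; have : sqrt_iter1 k ^+ 2 <= 1 by rewrite exprn_ile1.
by lra.
Qed.

Hypothesis cB : contraction B.
Hypothesis symB : symmetric B.

Let lB := cB.1.

Lemma sqrt_iter_linear k : linear (sqrt_iter k).
Proof.
elim: k => [|k IH] a x y /=; first by rewrite scaler0 addr0.
by rewrite lB !IH !scalerDr !scalerA (mulrC a) addrACA.
Qed.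

Lemma sqrt_iter_le k x : nrm (sqrt_iter k x) <= sqrt_iter1 k * nrm x.
Proof.
elim: k x => [|k IH] x /=; first by rewrite nrm0 mul0r.
have /andP[t0 _] := sqrt_iter1_itv k.
rewrite nrmZr ger0_norm ?invr_ge0// -mulrA ler_wpM2l ?invr_ge0// mulrDl mul1r.
apply: le_trans (nrmD _ _) (lerD (cB.2 x) _).
by rewrite (le_trans (IH _))// expr2 -mulrA ler_wpM2l.
Qed.

Lemma sqrt_iter_step k x : nrm (sqrt_iter k.+1 x - sqrt_iter k x) <=
  (sqrt_iter1 k.+1 - sqrt_iter1 k) * nrm x.
Proof.
elim: k x => [|k IH] x; first by rewrite [sqrt_iter 0 x]/= !subr0 sqrt_iter_le.
have /andP[t0 _] := sqrt_iter1_itv k; have /andP[s0 _] := sqrt_iter1_itv k.+1.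
have lS := sqrt_iter_linear.
have -> : sqrt_iter k.+2 x - sqrt_iter k.+1 x = (2^-1 : R)%:C%C *:
    (sqrt_iter k.+1 (sqrt_iter k.+1 x - sqrt_iter k x) +
     (sqrt_iter k.+1 (sqrt_iter k x) - sqrt_iter k (sqrt_iter k x))).
  rewrite (linB (lS k.+1)) subrKA.
  transitivity ((2^-1 : R)%:C%C *: (B x + sqrt_iter k.+1 (sqrt_iter k.+1 x)) -
    (2^-1 : R)%:C%C *: (B x + sqrt_iter k (sqrt_iter k x))) => //.
  by rewrite -scalerBr opprD addrACA subrr add0r.
rewrite nrmZr ger0_norm ?invr_ge0//.
have -> : sqrt_iter1 k.+2 - sqrt_iter1 k.+1 = 2^-1 *
    (sqrt_iter1 k.+1 * (sqrt_iter1 k.+1 - sqrt_iter1 k) +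
     (sqrt_iter1 k.+1 - sqrt_iter1 k) * sqrt_iter1 k).
  have E m : sqrt_iter1 m.+1 = 2^-1 * (1 + sqrt_iter1 m ^+ 2) by [].
  by rewrite (E k.+1) {2}(E k); ring.
rewrite -mulrA ler_wpM2l ?invr_ge0// mulrDl.
apply: le_trans (nrmD _ _) (lerD _ _).
  by rewrite (le_trans (sqrt_iter_le _ _))// -mulrA ler_wpM2l.
have d0 : 0 <= sqrt_iter1 k.+1 - sqrt_iter1 k.
  by have := sqr_ge0 (1 - sqrt_iter1 k); rewrite /=; lra.
by apply: le_trans (IH _) _; rewrite -mulrA ler_wpM2l// sqrt_iter_le.
Qed.

Lemma sqrt_iter_symmetric k : symmetric (sqrt_iter k).
Proof.
elim: k => [|k IH] x y /=; first by rewrite dot0l dot0r.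
by rewrite dotZl dotZr dotDl dotDr symB !IH conj_Creal// complex_real.
Qed.

(** As [sqrt_iter1] is monotone and bounded by 1, the iteration converges
   pointwise, to a symmetric contraction. *)
Lemma sqrt_iter_cvg : exists Y : H -> H,
  [/\ contraction Y, symmetric Y,
      forall x, sqrt_iter k x @[k --> \oo] --> Y x &
      forall x, Y x + Y x = B x + Y (Y x)].
Proof.
have ex x : exists l, sqrt_iter k x @[k --> \oo] --> l /\ nrm l <= nrm x.
  have [k|k|l xl ln] := @cvg_dominated_increments _ _ (sqrt_iter^~ x)
    (fun k => sqrt_iter1 k * nrm x) (nrm x).
  - by rewrite -mulrBl sqrt_iter_step.
  - by rewrite ler_piMl ?nrm_ge0//; case/andP: (sqrt_iter1_itv k).
  - by exists l; split=> //; move: ln; rewrite /= mul0r !subr0.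
have [Y /all_and2[Ylim Y1]] := choice ex.
have lY : linear Y.
  move=> a x y; apply: (limit_unique (Ylim _)).
  under eq_fun do rewrite sqrt_iter_linear.
  exact: cvgD (cvgZr (Ylim x)) (Ylim y).
exists Y; split=> // [x y|x].
  apply: (Re_dot_inj (phi := fun x => dot (Y x) y)) => [a v|v].
    by rewrite (linZ lY) dotZl.
  apply: limit_unique_real (cvg_Re_dot (w := y) (Ylim v)) _.
  under eq_fun do rewrite sqrt_iter_symmetric Re_dotC.
  by rewrite Re_dotC; apply: cvg_Re_dot; apply: Ylim.
apply: (limit_unique (F := \oo) (f := fun k => sqrt_iter k.+1 x + sqrt_iter k.+1 x)).
  by have := Ylim x; rewrite -cvg_shiftS => h; exact: (cvgD h h).
have -> : (fun k => sqrt_iter k.+1 x + sqrt_iter k.+1 x) =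
    (fun k => B x + sqrt_iter k (sqrt_iter k x)).
  apply/funext => k /=; rewrite -scalerDl -rmorphD/=.
  by rewrite -[2^-1 in X in X + _]mul1r -[2^-1 in X in _ + X]mul1r -splitr scale1r.
apply: cvgD; first exact: cvg_cst.
apply/cvg_nrm_seqP => e e0; have e2 : 0 < e / 2 by rewrite divr_gt0.
have [N hN] := (cvg_nrm_seqP _ _).1 (Ylim (Y x)) _ e2.
have [N' hN'] := (cvg_nrm_seqP _ _).1 (Ylim x) _ e2.
exists (maxn N N') => k; rewrite geq_max => /andP[/hN h1 /hN' h2].
rewrite -(subrKA (sqrt_iter k (Y x))) -(linB (sqrt_iter_linear k)).
apply: le_lt_trans (nrmD _ _) _; rewrite (splitr e); apply: ltrD => //.
apply: le_lt_trans h2; apply: le_trans (sqrt_iter_le _ _) _.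
by rewrite ler_piMl ?nrm_ge0//; case/andP: (sqrt_iter1_itv k).
Qed.

End iteration.
End square_roots.

Section square_root_operator.
Variable R : realType.
Implicit Types H K : hilbertType R.

Lemma sqrt_iter_intertwine H K (B : H -> H) (C : K -> K) (X : H -> K) :
  linear X -> (forall x, X (B x) = C (X x)) ->
  forall k x, X (sqrt_iter B k x) = sqrt_iter C k (X x).
Proof.
move=> lX XB; elim=> [|k IH] x /=; first exact: lin0.
by rewrite (linZ lX) (linD lX) XB !IH.
Qed.

Section defect.
Variables (H : hilbertType R) (B : H -> H).
Hypotheses (cB : contraction B) (symB : symmetric B).

Local Notation S := (sqrt_op (fun x => x - B x)).

(** Uniqueness of the positive square root: a positive Q with Q^2 = 1 - B
   commutes with B, hence with the root P = 1 - Y obtained from the iteration,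
   and (P - Q) (P + Q) (P - Q) = 0 is a sum of two positive operators, which
   therefore vanish. *)
Lemma sqrt_op_iter :
  [/\ bounded_op S, positive_op S, forall x, S (S x) = x - B x &
      forall x, sqrt_iter B k x @[k --> \oo] --> x - S x].
Proof.
have [Y [cY symY Ylim YE]] := sqrt_iter_cvg cB symB.
have lY := cY.1.
pose P x := x - Y x.
have lP : linear P by apply: linear_sub lY => a x y.
have posP : positive_op P.
  move=> x; rewrite /P dotBl.
  have -> : dot (Y x) x = (complex.Re (dot (Y x) x))%:C%C.
    by apply: dot_real; rewrite symY.
  rewrite dot_nrm subr_ge0 lecR; apply: le_trans (Re_dot_le _ _) _.
  by rewrite expr2 ler_wpM2r ?nrm_ge0// cY.2.
have PP x : P (P x) = x - B x.
  have -> : B x = Y x + Y x - Y (Y x) by rewrite YE addrK.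
  by rewrite /P (linB lY) -[in RHS]addrA [in RHS]opprD addrA.
have bP : bounded_op P.
  apply: (@bounded_lin _ _ _ _ lP 2) => // x; apply: le_trans (nrmD _ _) _.
  by rewrite nrmN mulr_natl mulr2n lerD2l cY.2.
have : [set Q : H -> H | [/\ bounded_op Q, positive_op Q &
    Q \o Q = fun x => x - B x]] S.
  by apply: (@getPex (H -> H)); exists P; split=> //; apply/funext.
move=> [bS posS SS]; have {}SS x : S (S x) = x - B x by exact: (congr1 (fun h => h x) SS).
have [lS _] := bounded_opP bS.
have SB x : S (B x) = B (S x).
  have BE y : B y = y - S (S y) by rewrite SS opprB subrKC.
  by rewrite (BE x) (linB lS) -BE.
have SY x : S (Y x) = Y (S x).
  apply: (@limit_unique _ _ _ \oo _ (fun k => S (sqrt_iter B k x))).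
    exact: bounded_cvg bS (Ylim x).
  under eq_fun do rewrite (sqrt_iter_intertwine lS SB).
  exact: Ylim.
have SP x : S (P x) = P (S x) by rewrite /P (linB lS) SY.
have PS x : S x = P x.
  apply/eqP; rewrite eq_sym -subr_eq0; apply/eqP.
  pose D z := P z - S z.
  have lD : linear D by apply: linear_sub.
  have symD : symmetric D.
    move=> y z; rewrite dotBl dotBr (positive_symmetric lP posP).
    by rewrite (positive_symmetric lS posS).
  have sum0 y : dot (P (D y)) (D y) + dot (S (D y)) (D y) = 0.
    rewrite -dotDl (_ : _ + _ = 0) ?dot0l//.
    by rewrite /D (linB lP) (linB lS) PP SS SP addrC subrKA subrr.
  have DD y : D (D y) = 0.
    have := sum0 y; have p0 := posP (D y); have s0 := posS (D y).
    move/eqP; rewrite paddr_eq0// => /andP[/eqP h1 /eqP h2].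
    by rewrite {1}/D (positive_form_eq0 lP posP h1) (positive_form_eq0 lS posS h2) subrr.
  apply: nrm_eq0; apply/eqP; rewrite -sqrf_eq0; apply/eqP/complexI.
  by rewrite -dot_nrm -/(D x) -symD DD dot0l.
split=> // x; rewrite PS /P opprB subrKC; exact: Ylim.
Qed.

Lemma sqrt_op_bounded : bounded_op S.
Proof. by have [] := sqrt_op_iter. Qed.

Lemma sqrt_opK x : S (S x) = x - B x.
Proof. by have [] := sqrt_op_iter. Qed.

Lemma sqrt_op_symmetric : symmetric S.
Proof.
by have [/bounded_opP[lS _] pS _ _] := sqrt_op_iter; apply: positive_symmetric.
Qed.

End defect.

(** The square roots are the identity minus limits of the same polynomials in B
   and in C, so they inherit the intertwining relation. *)
Lemma sqrt_op_intertwine H K (B : H -> H) (C : K -> K) (X : H -> K) :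
  contraction B -> symmetric B -> contraction C -> symmetric C ->
  bounded_op X -> (forall x, X (B x) = C (X x)) ->
  forall x, X (sqrt_op (fun y => y - B y) x) = sqrt_op (fun y => y - C y) (X x).
Proof.
move=> cB sB cC sC bX XB x; have [lX _] := bounded_opP bX.
have [_ _ _ /(_ x) limB] := sqrt_op_iter cB sB.
have [_ _ _ /(_ (X x)) limC] := sqrt_op_iter cC sC.
apply/oppr_inj/(addrI (X x)); rewrite -(linB lX).
apply: limit_unique (bounded_cvg bX limB) _.
by under eq_fun do rewrite (sqrt_iter_intertwine lX XB).
Qed.

End square_root_operator.

Section defect_operators.
Variables (R : realType) (H K : hilbertType R) (A : H -> K).
Hypothesis cA : contraction A.

Let bA := contraction_bounded cA.

Lemma adjoint_contraction : contraction (adjoint A).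
Proof.
split; first by case/bounded_opP: (bounded_adjoint bA).
have A1 x : nrm (A x) <= 1 * nrm x by rewrite mul1r cA.2.
by move=> y; have := nrm_adjoint_le bA ler01 A1 y; rewrite mul1r.
Qed.

Let cAs := adjoint_contraction.

Lemma contraction_adjoint_comp : contraction (adjoint A \o A).
Proof.
split=> [a x y /=|x]; first by rewrite cA.1 cAs.1.
exact: le_trans (cAs.2 _) (cA.2 _).
Qed.

Lemma symmetric_adjoint_comp : symmetric (adjoint A \o A).
Proof. by move=> x y /=; rewrite dot_adjointl// dot_adjoint. Qed.

End defect_operators.

(** * Square-summable families *)

Section square_summable_families.
Variables (R : realType) (I : choiceType) (K : hilbertType R).
Implicit Types (x y : l2 I K).

Lemma sumsq_le_seq (x : I -> K) (c : R) :
  (forall s, uniq s -> \sum_(i <- s) nrm (x i) ^+ 2 <= c) ->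
  (sumsq x <= c%:E)%E.
Proof.
move=> xc; apply: ge_ereal_sup => _ [X [fX _]] <-.
by rewrite fsbig_finite//= sumEFin lee_fin xc.
Qed.

Lemma seq_le_sumsq (x : I -> K) s : uniq s ->
  ((\sum_(i <- s) nrm (x i) ^+ 2)%:E <= sumsq x)%E.
Proof.
move=> us; apply: esum_ge; exists [set` s]; first by split=> //; exact: finite_seq.
by rewrite -sumEFin fsbig_seq.
Qed.

Lemma l2_nrm_sqr_le x (c : R) :
  (forall s, uniq s -> \sum_(i <- s) nrm (x i) ^+ 2 <= c) -> nrm x ^+ 2 <= c.
Proof. by move=> xc; rewrite -lee_fin l2_nrmE; apply: sumsq_le_seq. Qed.

Lemma seq_le_l2_nrm x s : uniq s -> \sum_(i <- s) nrm (x i) ^+ 2 <= nrm x ^+ 2.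
Proof. by move=> us; rewrite -lee_fin l2_nrmE; apply: seq_le_sumsq. Qed.

Lemma to_l2E (x : I -> K) i : x \in @l2_pred R I K -> to_l2 x i = x i.
Proof. by move=> xl; rewrite /to_l2 -[_ i]/(val _ i) insubdK. Qed.

Lemma mem_l2 (x : I -> K) (c : R) :
  (forall s, uniq s -> \sum_(i <- s) nrm (x i) ^+ 2 <= c) -> x \in @l2_pred R I K.
Proof. by move=> /sumsq_le_seq xc; apply: le_lt_trans xc (ltry _). Qed.

Lemma l2_sumE J (s : seq J) (P : pred J) (x : J -> l2 I K) i :
  (\sum_(j <- s | P j) x j) i = \sum_(j <- s | P j) x j i.
Proof. by apply: (big_morph (fun y : l2 I K => y i)). Qed.

Lemma l2_coord_bounded i : bounded_op (fun x => x i).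
Proof.
by apply: (@bounded_lin _ _ _ _ _ 1) => // x; rewrite mul1r l2_coord_le.
Qed.

(** The elementary tensor e_i (x) v. *)
Definition single (i : I) (v : K) : l2 I K :=
  to_l2 (fun j => if j == i then v else 0).

Lemma singleE i v j : single i v j = if j == i then v else 0.
Proof.
apply: to_l2E; apply: (@mem_l2 _ (nrm v ^+ 2)) => s us.
have [si|si] := boolP (i \in s).
  rewrite (bigD1_seq i)//= eqxx big1 ?addr0// => k /negPf ->.
  by rewrite nrm0 expr0n.
rewrite big_seq big1 ?sqr_ge0// => k ks; case: eqP => [ki|_].
  by rewrite -ki ks in si.
by rewrite nrm0 expr0n.
Qed.

Lemma rsum_single (u : I -> R) i : (forall j, j != i -> u j = 0) -> rsum u = u i.
Proof.
move=> u0.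
have E (v : I -> \bar R) : (forall j, 0 <= v j)%E ->
    (forall j, j != i -> v j = 0%E) -> esum [set: I] v = v i.
  move=> v0 vi; rewrite -(esum_set1 (v0 i)) [RHS]esum_mkcond.
  apply: eq_esum => j _; rewrite in_set1; case: eqP => [//|/eqP/vi //].
rewrite /rsum (E (EFin \o u)^\+%E) ?(E (EFin \o u)^\-%E).
- by rewrite -[u i]/(fine ((EFin \o u) i)) {3}(funeposneg (EFin \o u)).
- by move=> j; rewrite funeneg_ge0.
- by move=> j /u0 h; rewrite funenegE /= h oppr0 maxxx.
- by move=> j; rewrite funepos_ge0.
- by move=> j /u0 h; rewrite funeposE /= h maxxx.
Qed.

Lemma dot_single i v x : dot (single i v) x = dot v (x i).
Proof.
rewrite [LHS]/(l2dot _ _) /l2dot.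
rewrite (@rsum_single _ i) ?(@rsum_single _ i) ?singleE ?eqxx.
- by case: (dot _ _).
- by move=> j /negPf ji; rewrite singleE ji dot0l.
- by move=> j /negPf ji; rewrite singleE ji dot0l.
Qed.

Lemma dot_singler i v x : dot x (single i v) = dot (x i) v.
Proof. by rewrite dotC dot_single -dotC. Qed.

End square_summable_families.

Section finite_sums.
Variables (R : realType) (J : finType) (K : hilbertType R).
Implicit Types x y : l2 J K.

Lemma mem_l2_fin (x : J -> K) : x \in @l2_pred R J K.
Proof.
apply: (@mem_l2 _ _ _ _ (\sum_j nrm (x j) ^+ 2)) => s us.
rewrite big_uniq//= [leRHS](bigID (mem s))/= lerDl.
by apply: sumr_ge0 => j _; exact: sqr_ge0.
Qed.

Lemma l2_fin_decomp x : x = \sum_j single j (x j).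
Proof.
apply: l2E => j; rewrite l2_sumE (bigD1 j)//= singleE eqxx big1 ?addr0// => k.
by rewrite singleE eq_sym => /negPf ->.
Qed.

Lemma dot_l2_fin x y : dot x y = \sum_j dot (x j) (y j).
Proof.
rewrite [in LHS](l2_fin_decomp x) dot_suml.
by apply: eq_bigr => j _; rewrite dot_single.
Qed.

Lemma nrm_l2_fin x : nrm x ^+ 2 = \sum_j nrm (x j) ^+ 2.
Proof.
apply: complexI; rewrite -dot_nrm dot_l2_fin rmorph_sum/=.
by apply: eq_bigr => j _; rewrite dot_nrm.
Qed.

End finite_sums.

Section ampliation.
Variables (R : realType) (I : choiceType).
Implicit Types K L : hilbertType R.

Lemma l2mapE K L (A : K -> L) (x : l2 I K) i : bounded_op A -> l2map A x i = A (x i).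
Proof.
move=> /bounded_opP[lA [c c0 Ac]]; apply: to_l2E.
apply: (@mem_l2 _ _ _ _ (c ^+ 2 * nrm x ^+ 2)) => s us.
apply: le_trans (ler_wpM2l (sqr_ge0 c) (seq_le_l2_nrm x us)).
rewrite mulr_sumr; apply: ler_sum => j _; rewrite -exprMn.
by rewrite ler_pXn2r ?nnegrE ?mulr_ge0 ?nrm_ge0.
Qed.

Lemma l2map_linear K L (A : K -> L) : bounded_op A -> linear (@l2map R I K L A).
Proof.
move=> bA a x y; apply: l2E => i; rewrite l2_addE l2_scaleE !l2mapE//.
by case: bA => ->.
Qed.

End ampliation.

(** * Words and right creation operators *)

Section words.
Variable n : nat.
Implicit Types (s : seq (seq 'I_n)) (a b : seq 'I_n).

Definition tails i s := [seq behead a | a <- s & ohead a == Some i].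

Definition inits i s := [seq rev a | a <- tails i [seq rev a | a <- s]].

Lemma mem_tails i s b : (b \in tails i s) = (i :: b \in s).
Proof.
apply/mapP/idP => [[[|j a]]|bs]; rewrite ?mem_filter//=.
  by case/andP=> /eqP [->] h ->.
by exists (i :: b) => //; rewrite mem_filter/= eqxx.
Qed.

Lemma tails_uniq i s : uniq s -> uniq (tails i s).
Proof.
move=> us; rewrite map_inj_in_uniq ?filter_uniq// => a b.
rewrite !mem_filter => /andP[+ _] /andP[+ _].
by case: a b => [//|j a] [//|k b] /eqP[->] /eqP[->] /= ->.
Qed.

Lemma inits_uniq i s : uniq s -> uniq (inits i s).
Proof.
move=> us; rewrite map_inj_uniq; last exact: (can_inj revK).
by rewrite tails_uniq// map_inj_uniq//; exact: (can_inj revK).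
Qed.

(** The recursion over finite sets of words by the first letter; [inits] gives
   the one by the last letter. *)
Lemma big_tails (V : nmodType) (phi : seq 'I_n -> V) s :
  \sum_(a <- s) phi a = \sum_(a <- s | a == [::]) phi a +
                        \sum_i \sum_(b <- tails i s) phi (i :: b).
Proof.
elim: s => [|[|i a] s IH].
- by rewrite !big_nil add0r big1// => i _; rewrite /tails big_nil.
- by rewrite !big_cons/= IH addrA.
rewrite !big_cons/= IH addrCA; congr (_ + _).
rewrite [RHS](bigD1 i)//= [in LHS](bigD1 i)//= addrA; congr (_ + _).
  by rewrite /tails/= eqxx/= big_cons.
apply: eq_bigr => j ji; rewrite /tails/= (_ : (Some i == Some j) = false)//.
by apply/eqP => -[ij]; rewrite ij eqxx in ji.
Qed.

Lemma big_inits (V : nmodType) (phi : seq 'I_n -> V) s :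
  \sum_(a <- s) phi a = \sum_(a <- s | a == [::]) phi a +
                        \sum_i \sum_(b <- inits i s) phi (rcons b i).
Proof.
have := big_tails (fun a => phi (rev a)) [seq rev a | a <- s].
rewrite !big_map; under eq_bigr do rewrite revK; move=> ->; congr (_ + _).
  apply: eq_big => [a|a _]; last by rewrite revK.
  by rewrite -(inj_eq (can_inj revK)) revK.
apply: eq_bigr => i _; rewrite /inits [RHS]big_map; apply: eq_bigr => b _.
by rewrite rev_cons.
Qed.

End words.

Lemma ler_sum_subset (R : numDomainType) (I : eqType) (s t : seq I) (u : I -> R) :
  uniq s -> uniq t -> {subset s <= t} -> (forall i, 0 <= u i) ->
  \sum_(i <- s) u i <= \sum_(i <- t) u i.
Proof.
move=> us ut st u0.
have /(perm_big _) -> : perm_eq s [seq i <- t | i \in s].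
  apply: uniq_perm; rewrite ?filter_uniq// => i; rewrite mem_filter.
  by case: (boolP (i \in s)) => // /st ->.
rewrite big_filter [leRHS](bigID (mem s))/= lerDl.
by apply: sumr_ge0.
Qed.

Section right_shift.
Variables (R : realType) (n : nat) (K L : hilbertType R).

(** The words (b followed by i) are pairwise distinct, so a row of operators
   A_i with sum A_i^* A_i bounded by c^2 is amplified, together with right
   creation operators, without increasing the bound. *)
Lemma right_shift_le (A : 'I_n -> K -> L) (c : R) (y : l2 (seq 'I_n) K)
    (x : seq 'I_n -> L) :
  (forall v, \sum_i nrm (A i v) ^+ 2 <= c ^+ 2 * nrm v ^+ 2) ->
  x [::] = 0 -> (forall b i, x (rcons b i) = A i (y b)) ->
  forall s, uniq s -> \sum_(a <- s) nrm (x a) ^+ 2 <= c ^+ 2 * nrm y ^+ 2.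
Proof.
move=> Ac x0 xA s us; rewrite big_inits big1 => [|a /eqP ->]; last first.
  by rewrite x0 nrm0 expr0n.
rewrite add0r; pose U := undup (flatten [seq inits i s | i <- enum 'I_n]).
apply: (@le_trans _ _ (\sum_i \sum_(b <- U) nrm (A i (y b)) ^+ 2)).
  apply: ler_sum => i _; under eq_bigr do rewrite xA.
  apply: ler_sum_subset => [||b bi|b]; rewrite ?inits_uniq ?undup_uniq ?sqr_ge0//.
  rewrite mem_undup; apply/flattenP; exists (inits i s) => //.
  by apply/mapP; exists i; rewrite ?mem_enum.
rewrite exchange_big/=.
apply: le_trans (ler_wpM2l (sqr_ge0 c) (seq_le_l2_nrm y (undup_uniq _))).
by rewrite mulr_sumr; apply: ler_sum => b _.
Qed.

Lemma LambdaE i (A : K -> L) (y : l2 (seq 'I_n) K) a : bounded_op A ->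
  Lambda i A y a =
  if a == rcons (take (size a).-1 a) i then A (y (take (size a).-1 a)) else 0.
Proof.
move=> bA; apply: to_l2E; have [lA [c c0 Ac]] := bounded_opP bA.
apply: mem_l2 (right_shift_le (A := fun j v => if j == i then A v else 0) _ _ _).
- move=> v; rewrite (bigD1 i)//= eqxx big1 => [|j /negPf ->]; last first.
    by rewrite nrm0 expr0n.
  by rewrite addr0 -exprMn ler_pXn2r ?nnegrE ?mulr_ge0 ?nrm_ge0.
- by [].
move=> b j /=; rewrite size_rcons/= -cats1 take_size_cat// cats1 eqseq_rcons eqxx.
by [].
Qed.

Lemma Lambda_nil i (A : K -> L) (y : l2 (seq 'I_n) K) : bounded_op A ->
  Lambda i A y [::] = 0.
Proof. by move=> bA; rewrite LambdaE. Qed.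

Lemma Lambda_rcons i (A : K -> L) (y : l2 (seq 'I_n) K) b j : bounded_op A ->
  Lambda i A y (rcons b j) = if j == i then A (y b) else 0.
Proof.
move=> bA; rewrite LambdaE// size_rcons/= -cats1 take_size_cat// cats1.
by rewrite eqseq_rcons eqxx.
Qed.

Variables (r : R) (A : 'I_n -> K -> L).
Hypothesis bA : forall i, bounded_op (A i).

Definition row_shift (y : l2 (seq 'I_n) K) : l2 (seq 'I_n) L :=
  \sum_i r%:C%C *: Lambda i (A i) y.

Lemma row_shift_nil y : row_shift y [::] = 0.
Proof.
rewrite l2_sumE big1// => i _.
by rewrite l2_scaleE Lambda_nil// scaler0.
Qed.

Lemma row_shift_rcons y b i : row_shift y (rcons b i) = r%:C%C *: A i (y b).
Proof.
rewrite l2_sumE (bigD1 i)// l2_scaleE Lambda_rcons// eqxx big1 => [|j ji].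
  exact: addr0.
by rewrite l2_scaleE Lambda_rcons// eq_sym (negPf ji) scaler0.
Qed.

Lemma row_shift_linear : linear row_shift.
Proof.
move=> a x y; apply: l2E => w; rewrite l2_addE l2_scaleE.
case/lastP: w => [|b i]; first by rewrite !row_shift_nil scaler0 addr0.
have [lA _] := bounded_opP (bA i).
rewrite !row_shift_rcons l2_addE l2_scaleE lA scalerDr !scalerA.
by rewrite [r%:C%C * a]mulrC.
Qed.

Lemma row_shift_le : 0 <= r ->
  (forall v, \sum_i nrm (A i v) ^+ 2 <= nrm v ^+ 2) ->
  forall y, nrm (row_shift y) <= r * nrm y.
Proof.
move=> r0 A1 y.
rewrite -(@ler_pXn2r _ 2) ?nnegrE ?mulr_ge0 ?nrm_ge0// exprMn.
apply: l2_nrm_sqr_le.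
apply: (@right_shift_le (fun i v => r%:C%C *: A i v)).
- move=> v; apply: le_trans (ler_wpM2l (sqr_ge0 r) (A1 v)).
  rewrite mulr_sumr; apply: ler_sum => i _.
  by rewrite nrmZr ger0_norm// exprMn.
- exact: row_shift_nil.
- by move=> b i; rewrite row_shift_rcons.
Qed.

End right_shift.

(** * Neumann series *)

Section neumann.
Variables (R : realType) (H : hilbertType R) (M : H -> H) (r : R).
Hypotheses (lM : linear M) (r0 : 0 <= r) (r1 : r < 1)
  (Mr : forall x, nrm (M x) <= r * nrm x).

Lemma neumann_inj x y : x - M x = y - M y -> x = y.
Proof.
move=> xy; apply/eqP; rewrite -subr_eq0; apply/eqP; apply: nrm_eq0.
have e : x - y = M (x - y).
  apply/eqP; rewrite subr_eq -{1}(subrK (M x) x) xy (linB lM).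
  by rewrite addrC addrCA addrC.
have := Mr (x - y); rewrite -e; have := nrm_ge0 (x - y).
move: (nrm _) => t t0 h; apply/eqP; rewrite eq_le t0 andbT leNgt.
by apply/negP => /(ltr_pM2r) tp; move: h; rewrite leNgt -{2}[t]mul1r tp r1.
Qed.

(** The geometric series, as the limit of the iteration u -> w + M u. *)
Lemma inv_opP : let L x := x - M x in
  [/\ bounded_op (inv_op L), forall w, L (inv_op L w) = w &
      forall x, inv_op L (L x) = x].
Proof.
move=> L.
suff [B [bB LB BL]] : exists B : H -> H,
    [/\ bounded_op B, L \o B = id & B \o L = id].
  have [bI LI IL] := @getPex (H -> H) [set B : H -> H |
    [/\ bounded_op B, L \o B = id & B \o L = id]] (ex_intro _ B (And3 bB LB BL)).
  split=> // [w|x]; first exact: (congr1 (fun h => h w) LI).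
  exact: (congr1 (fun h => h x) IL).
have d0 : 0 < 1 - r by rewrite subr_gt0.
have ex w : exists z, L z = w /\ nrm z <= (1 - r)^-1 * nrm w.
  pose u := fix u k := if k is k'.+1 then w + M (u k') else 0.
  have uE k : u k.+1 = w + M (u k) by [].
  pose t k := (1 - r ^+ k) / (1 - r) * nrm w.
  have ut k : nrm (u k.+1 - u k) <= t k.+1 - t k.
    have -> : t k.+1 - t k = r ^+ k * nrm w.
      by rewrite /t exprS; field; rewrite gt_eqF.
    elim: k => [|k IH]; first by rewrite /= subr0 (lin0 lM) addr0 mul1r.
    rewrite (uE k.+1) {2}(uE k) opprD addrACA subrr add0r -(linB lM).
    by apply: le_trans (Mr _) _; rewrite exprS -mulrA ler_wpM2l.
  have tM k : t k <= (1 - r)^-1 * nrm w.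
    rewrite /t ler_wpM2r ?nrm_ge0// ler_pdivrMr// mulVf ?gt_eqF//.
    by rewrite gerBl exprn_ge0.
  have [z uz] := cvg_dominated_increments ut tM.
  rewrite /t expr0 subrr !mul0r !subr0 => zn; exists z; split=> //.
  apply/eqP; rewrite subr_eq; apply/eqP.
  apply: (@limit_unique _ _ _ \oo _ (fun k => u k.+1)).
    by have := uz; rewrite -cvg_shiftS.
  apply: cvgD; first exact: cvg_cst.
  by apply: bounded_cvg uz; apply: bounded_lin Mr.
have [B /all_and2[LB Bn]] := choice ex.
have LL : linear L by apply: linear_sub lM => a x y.
exists B; split; first 1 last.
- by apply/funext => w /=.
- by apply/funext => x /=; apply: neumann_inj; rewrite -/(L _) LB.
apply: (@bounded_lin _ _ _ _ _ (1 - r)^-1) => //; last by rewrite invr_ge0 ltW.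
by move=> a x y; apply: neumann_inj; rewrite -/(L _) LB -/(L _) LL !LB.
Qed.

End neumann.

(** * Row contractions *)

Section row_contractions.
Variables (R : realType) (n : nat) (H : hilbertType R) (F : 'I_n -> H -> H).
Implicit Types (h : H) (a b : seq 'I_n) (x v : l2 'I_n H).

Definition row_contraction : Prop :=
  (forall i, bounded_op (F i)) /\ (opnorm (rowop F) <= 1)%E.

Definition row_defect : H -> H :=
  sqrt_op (fun h => h - \sum_i F i (adjoint (F i) h)).

Definition col_defect : l2 'I_n H -> l2 'I_n H :=
  sqrt_op (fun x => x - adjoint (rowop F) (rowop F x)).

(** The operator F_a^*, computed letter by letter. *)
Definition wadj a h : H := foldl (fun h i => adjoint (F i) h) h a.

Hypothesis cF : row_contraction.

Let bF := cF.1.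

Lemma rowop_contraction : contraction (rowop F).
Proof.
have lr : linear (rowop F).
  move=> a x y; rewrite /rowop scaler_sumr -big_split; apply: eq_bigr => i _ /=.
  by have [lF _] := bounded_opP (bF i); rewrite lF.
split=> // x; rewrite -[leRHS]mul1r.
exact: ((opnorm_leP lr ler01).1 cF.2 x).
Qed.

Let cr := rowop_contraction.
Let br := contraction_bounded cr.

Lemma rowop_single i h : rowop F (single i h) = F i h.
Proof.
rewrite /rowop (bigD1 i)//= singleE eqxx big1 ?addr0// => j ji.
by rewrite singleE (negPf ji) lin0//; have [] := bounded_opP (bF j).
Qed.

Lemma adjoint_rowopE h i : adjoint (rowop F) h i = adjoint (F i) h.
Proof.
by apply: dot_injr => w; rewrite -dot_single -!dot_adjoint// rowop_single.
Qed.

Lemma rowop_adjoint h :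
  rowop F (adjoint (rowop F) h) = \sum_i F i (adjoint (F i) h).
Proof. by apply: eq_bigr => i _; rewrite adjoint_rowopE. Qed.

Lemma sum_nrm_adjoint h : \sum_i nrm (adjoint (F i) h) ^+ 2 <= nrm h ^+ 2.
Proof.
under eq_bigr do rewrite -adjoint_rowopE.
rewrite -nrm_l2_fin ler_pXn2r ?nnegrE ?nrm_ge0//.
exact: (adjoint_contraction cr).2.
Qed.

Let B h := \sum_i F i (adjoint (F i) h).

Lemma row_gram_contraction : contraction B.
Proof.
have := contraction_adjoint_comp (adjoint_contraction cr).
by congr contraction; apply/funext => h /=; rewrite adjointK// rowop_adjoint.
Qed.

Lemma row_gram_symmetric : symmetric B.
Proof.
have := symmetric_adjoint_comp (adjoint_contraction cr).
by congr symmetric; apply/funext => h /=; rewrite adjointK// rowop_adjoint.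
Qed.

Let cB := row_gram_contraction.
Let sB := row_gram_symmetric.
Let cC := contraction_adjoint_comp cr.
Let sC := symmetric_adjoint_comp cr.

Lemma row_defect_bounded : bounded_op row_defect.
Proof. exact: sqrt_op_bounded cB sB. Qed.

Lemma col_defect_bounded : bounded_op col_defect.
Proof. exact: sqrt_op_bounded cC sC. Qed.

Lemma row_defect_symmetric : symmetric row_defect.
Proof. exact: sqrt_op_symmetric cB sB. Qed.

Lemma col_defect_symmetric : symmetric col_defect.
Proof. exact: sqrt_op_symmetric cC sC. Qed.

Lemma row_defectK h : row_defect (row_defect h) = h - \sum_i F i (adjoint (F i) h).
Proof. exact: sqrt_opK cB sB h. Qed.

Lemma col_defectK x : col_defect (col_defect x) = x - adjoint (rowop F) (rowop F x).
Proof. exact: sqrt_opK cC sC x. Qed.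

(** F F^* and F^* F are intertwined by F, hence so are the square roots. *)
Lemma rowop_col_defect x : rowop F (col_defect x) = row_defect (rowop F x).
Proof.
apply: (sqrt_op_intertwine cC sC cB sB br) => y /=.
by rewrite rowop_adjoint.
Qed.

Lemma adjoint_row_defect h :
  adjoint (rowop F) (row_defect h) = col_defect (adjoint (rowop F) h).
Proof.
apply: dot_inj => x; rewrite dot_adjointl// row_defect_symmetric.
by rewrite -rowop_col_defect -dot_adjointl// col_defect_symmetric.
Qed.

Lemma nrm_row_defect h :
  nrm (row_defect h) ^+ 2 + \sum_i nrm (adjoint (F i) h) ^+ 2 = nrm h ^+ 2.
Proof.
apply: complexI; rewrite rmorphD rmorph_sum/= -!dot_nrm.
rewrite row_defect_symmetric row_defectK dotBr dot_sumr.
under [X in _ + X = _]eq_bigr do rewrite -dot_nrm dot_adjointl//.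
by rewrite subrK.
Qed.

Lemma dot_wprod a h h' : dot (wprod F a h) h' = dot h (wadj a h').
Proof. by elim: a h' => [|i a IH] h' //=; rewrite dot_adjoint// IH. Qed.

Lemma dot_wadj a h h' : dot (wadj a h) h' = dot h (wprod F a h').
Proof. by rewrite dotC -dot_wprod -dotC. Qed.

(** Since |Delta h|^2 = |h|^2 - sum_i |F_i^* h|^2, the sum telescopes over the
   length of the words. *)
Lemma sum_row_defect_wadj s h : uniq s ->
  \sum_(a <- s) nrm (row_defect (wadj a h)) ^+ 2 <= nrm h ^+ 2.
Proof.
have [m] : exists m, all (fun a => size a < m)%N s.
  exists (\max_(a <- s) size a).+1; apply/allP => a sa.
  by rewrite ltnS; apply: (@leq_bigmax_seq _ _ xpredT size).
elim: m s h => [|m IH] s h sm us.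
  by case: s sm {us} => [|//]; rewrite big_nil sqr_ge0.
rewrite big_tails -nrm_row_defect; apply: lerD.
  have := ler_sum_subset (filter_uniq (pred1 [::]) us) (_ : uniq [:: [::]])
    _ (fun a => sqr_ge0 (nrm (row_defect (wadj a h)))).
  rewrite big_seq1 big_filter; apply=> // a.
  by rewrite mem_filter mem_seq1 => /andP[].
apply: ler_sum => i _; apply: IH (tails_uniq _ us).
by apply/allP => b; rewrite mem_tails => /(allP sm).
Qed.

Lemma sum_wadj k s h : uniq s -> all (fun a => size a == k) s ->
  \sum_(a <- s) nrm (wadj a h) ^+ 2 <= nrm h ^+ 2.
Proof.
elim: k s h => [|k IH] s h us sk.
  have := ler_sum_subset us (_ : uniq [:: [::]]) _
    (fun a => sqr_ge0 (nrm (wadj a h))).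
  rewrite big_seq1; apply=> // a /(allP sk)  /=.
  by rewrite mem_seq1 size_eq0.
rewrite big_tails big_seq_cond big1 ?add0r => [|a /andP[/(allP sk)]]; last first.
  by move=> + /eqP ae; rewrite ae.
apply: le_trans (sum_nrm_adjoint h); apply: ler_sum => i _.
apply: IH (tails_uniq _ us) _.
by apply/allP => b; rewrite mem_tails => /(allP sk).
Qed.

End row_contractions.

(** * The characteristic function of a row contraction *)

Section characteristic_function.
Variables (R : realType) (n : nat) (H : hilbertType R) (F : 'I_n -> H -> H).
Implicit Types (h : H) (a b : seq 'I_n) (v : l2 'I_n H).
Implicit Type x : l2 (seq 'I_n) (l2 'I_n H).

(** [charfun_r] and [charfun] as functions of the row F alone: the operators T
   enter the characteristic function only through F = f(T). *)
Definition char_r (r : R) x : l2 (seq 'I_n) H :=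
  - l2map (rowop F) x
  + l2map (row_defect F)
      (inv_op
        (fun y => y - \sum_i r%:C%C *: Lambda i (adjoint (F i)) y)
        (\sum_i r%:C%C *:
           Lambda i (fun v => v i) (l2map (col_defect F) x))).

Definition char_op x : l2 (seq 'I_n) H := lim (char_r r x @[r --> (1 : R)^'-]).

(** The Fourier coefficients of the characteristic function. *)
Definition theta a v : H :=
  if a is i :: b then row_defect F (wadj F b (col_defect F v i))
  else - rowop F v.

Hypothesis cF : row_contraction F.

Let bF := cF.1.
Let cr := rowop_contraction cF.
Let br := contraction_bounded cr.
Let brd := row_defect_bounded cF.
Let bcd := col_defect_bounded cF.

Let bFs i : bounded_op (adjoint (F i)) := bounded_adjoint (bF i).

(** The contractivity of the characteristic function, up to a constant and at
   the tensors of the empty word. *)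
Lemma theta_l2 v : (theta^~ v) \in @l2_pred R (seq 'I_n) H.
Proof.
apply: (@mem_l2 _ _ _ _ (nrm v ^+ 2 + \sum_i nrm (col_defect F v i) ^+ 2)).
move=> s us; rewrite big_tails; apply: lerD.
  have := ler_sum_subset (filter_uniq (pred1 [::]) us) (_ : uniq [:: [::]])
    _ (fun a => sqr_ge0 (nrm (theta a v))).
  rewrite big_seq1 big_filter => h.
  have {}h := h isT; apply: le_trans (h _) _.
    by move=> a; rewrite mem_filter mem_seq1 => /andP[].
  by rewrite /= nrmN ler_pXn2r ?nnegrE ?nrm_ge0// cr.2.
apply: ler_sum => i _.
exact: (sum_row_defect_wadj cF (col_defect F v i) (tails_uniq i us)).
Qed.

Lemma char_resolvent (r : R) : 0 <= r -> r < 1 ->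
  let L y := y - row_shift r (fun i => adjoint (F i)) y in
  [/\ bounded_op (inv_op L), forall w, L (inv_op L w) = w &
      forall y, inv_op L (L y) = y].
Proof.
move=> r0 r1; apply: (inv_opP _ r0 r1); first exact: row_shift_linear bFs.
exact: row_shift_le bFs r0 (sum_nrm_adjoint cF).
Qed.

(** The resolvent equation determines the coordinate at a word from the one at
   the word without its last letter. *)
Lemma char_r_single (r : R) v a : 0 <= r -> r < 1 ->
  char_r r (single [::] v) a = (r ^+ size a)%:C%C *: theta a v.
Proof.
move=> r0 r1; have [_ LI IL] := char_resolvent r0 r1.
set x := single _ _.
have bP i : bounded_op (fun v : l2 'I_n H => v i) by exact: l2_coord_bounded.
set w := row_shift r (fun i (v : l2 'I_n H) => v i) (l2map (col_defect F) x).
rewrite /char_r -/(row_shift r (fun i v => v i) _) -/w.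
set y := inv_op _ w.
have yE : y = w + row_shift r (fun i => adjoint (F i)) y.
  by apply/eqP; rewrite -subr_eq; apply/eqP; apply: LI.
have y_nil : y [::] = 0.
  by rewrite {1}yE l2_addE !row_shift_nil// addr0.
have y_rcons b i : y (rcons b i) = r%:C%C *: l2map (col_defect F) x b i +
    r%:C%C *: adjoint (F i) (y b).
  by rewrite {1}yE l2_addE !row_shift_rcons.
have ya b : y b = if b is i :: c
    then (r ^+ size b)%:C%C *: wadj F c (col_defect F v i) else 0.
  elim/last_ind: b => [//|b i IH].
  rewrite y_rcons IH l2mapE// singleE.
  case: b {IH} => [|j b] /=.
    have [lA _] := bounded_opP (bFs i).
    by rewrite (lin0 lA) scaler0 addr0 expr1.
  have [lA _] := bounded_opP (bFs i); have [lcd _] := bounded_opP bcd.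
  rewrite (lin0 lcd) l2_zeroE scaler0 add0r (linZ lA) scalerA -rmorphM/=.
  by rewrite /wadj foldl_rcons size_rcons -exprS.
have [lrd _] := bounded_opP brd; have [lr _] := bounded_opP br.
rewrite l2_addE l2_oppE !l2mapE// singleE ya.
case: a => [|i a] /=; first by rewrite (lin0 lrd) addr0 expr0 scale1r.
by rewrite (lin0 lr) oppr0 add0r (linZ lrd).
Qed.

End characteristic_function.

(** * Fourier coefficients and Gram matrices *)

Lemma one_sub_expr_le (R : realDomainType) (r : R) m :
  0 <= r -> r <= 1 -> 1 - r ^+ m <= m%:R * (1 - r).
Proof.
move=> r0 r1; elim: m => [|m IH]; first by rewrite expr0 subrr mul0r.
rewrite exprS -natr1 mulrDl mul1r.
have rm : r ^+ m <= 1 by rewrite exprn_ile1.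
have rm0 : 0 <= r ^+ m by rewrite exprn_ge0.
by nra.
Qed.

Section radial_limits.
Variables (R : realType) (n : nat) (K : hilbertType R).

(** Radial scaling converges strongly to the identity: outside a finite set of
   words the family has small norm, and on that set r^|a| tends to 1
   uniformly. *)
Lemma radial_cvg (x : l2 (seq 'I_n) K) (y : R -> l2 (seq 'I_n) K) :
  (forall (r : R) a, 0 <= r -> r < 1 -> y r a = (r ^+ size a)%:C%C *: x a) ->
  y r @[r --> (1 : R)^'-] --> x.
Proof.
move=> yx; apply/cvg_nrmP => e e0.
have e2 : 0 < e ^+ 2 / 4 by rewrite divr_gt0// exprn_gt0.
have [s us sx] : exists2 s, uniq s &
    nrm x ^+ 2 - e ^+ 2 / 4 < \sum_(a <- s) nrm (x a) ^+ 2.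
  apply: contrapT => h; have := @l2_nrm_sqr_le _ _ _ x (nrm x ^+ 2 - e ^+ 2 / 4).
  suff H : forall s, uniq s ->
      \sum_(i <- s) nrm (x i) ^+ 2 <= nrm x ^+ 2 - e ^+ 2 / 4.
    by move=> /(_ H); lra.
  by move=> s us; rewrite leNgt; apply/negP => sx; apply: h; exists s.
pose m := \max_(a <- s) size a.
pose d := e ^+ 2 / 4 / (m%:R * nrm x ^+ 2 + 1).
have D0 : 0 < m%:R * nrm x ^+ 2 + 1 by rewrite ltr_wpDl// mulr_ge0// sqr_ge0.
have d0 : 0 < d by rewrite divr_gt0.
have near1 : \forall r \near (1 : R)^'-, [/\ 0 <= r, r < 1 & 1 - r < d].
  near=> r; split.
  - by near: r; apply: nbhs_left_ge; exact: ltr01.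
  - by near: r; exact: nbhs_left_lt.
  - rewrite ltrBlDr -ltrBlDl; near: r; apply: nbhs_left_gt.
    by rewrite ltrBlDr ltrDl.
apply: filterS near1 => r [r0 r1 rd].
suff : nrm (x - y r) ^+ 2 <= e ^+ 2 / 2.
  move=> h; rewrite -(@ltr_pXn2r _ 2) ?nnegrE ?nrm_ge0 ?ltW//.
  by apply: le_lt_trans h _; have := exprn_gt0 2 e0; lra.
apply: l2_nrm_sqr_le => t ut.
have xyE a : nrm ((x - y r) a) ^+ 2 = (1 - r ^+ size a) ^+ 2 * nrm (x a) ^+ 2.
  rewrite l2_addE l2_oppE yx// -[X in X - _]scale1r -scalerBl.
  rewrite -[1]/(1%:C%C) -rmorphB/= nrmZr exprMn; congr (_ * _).
  by rewrite real_normK// num_real.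
have ra (a : seq 'I_n) : 0 <= r ^+ size a <= 1.
  by rewrite exprn_ge0//= exprn_ile1// ltW.
rewrite (bigID (mem s))/=.
have h1 : \sum_(a <- t | a \in s) nrm ((x - y r) a) ^+ 2 <= e ^+ 2 / 4.
  rewrite -big_filter.
  apply: le_trans (ler_sum_subset (filter_uniq _ ut) us _ _) _.
  - by move=> a; rewrite mem_filter => /andP[].
  - by move=> a; exact: sqr_ge0.
  apply: (@le_trans _ _ (\sum_(a <- s) (m%:R * (1 - r)) * nrm (x a) ^+ 2)).
    rewrite big_seq [leRHS]big_seq; apply: ler_sum => a sa; rewrite xyE.
    apply: ler_wpM2r; first exact: sqr_ge0.
    have am : (size a <= m)%N by apply: (@leq_bigmax_seq _ _ xpredT size).
    have /andP[ra0 ra1] := ra a.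
    apply: (@le_trans _ _ (1 - r ^+ size a)).
      by rewrite expr2 ler_piMr ?subr_ge0// gerBl.
    apply: le_trans (one_sub_expr_le _ r0 (ltW r1)) _.
    by rewrite ler_wpM2r ?ler_nat// subr_ge0 ltW.
  rewrite -mulr_sumr.
  apply: le_trans (ler_wpM2l _ (seq_le_l2_nrm x us)) _.
    by rewrite mulr_ge0// subr_ge0 ltW.
  move: rd; rewrite ltr_pdivlMr// => rd.
  have : 0 <= 1 - r by rewrite subr_ge0 ltW.
  by move: rd; rewrite mulrDr mulr1 mulrCA; rewrite [m%:R * _ * _]mulrAC [m%:R * nrm x ^+ 2 * _]mulrC; lra.
have h2 : \sum_(a <- t | a \notin s) nrm ((x - y r) a) ^+ 2 <= e ^+ 2 / 4.
  apply: (@le_trans _ _ (\sum_(a <- t | a \notin s) nrm (x a) ^+ 2)).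
    apply: ler_sum => a _; rewrite xyE ler_piMl ?sqr_ge0//.
    by have /andP[ra0 ra1] := ra a; rewrite exprn_ile1// ?subr_ge0// gerBl.
  have ust : uniq (s ++ [seq a <- t | a \notin s]).
    rewrite cat_uniq us filter_uniq// andbT; apply/hasPn => a.
    by rewrite mem_filter => /andP[].
  have := seq_le_l2_nrm x ust; rewrite big_cat big_filter /=; lra.
lra.
Unshelve. all: by end_near.
Qed.

End radial_limits.

Section fourier_coefficients.
Variables (R : realType) (n : nat) (H : hilbertType R) (F : 'I_n -> H -> H).
Implicit Types (h d e : H) (a b : seq 'I_n) (v : l2 'I_n H).
Hypothesis cF : row_contraction F.

Let bF := cF.1.
Let cr := rowop_contraction cF.
Let br := contraction_bounded cr.

(** The characteristic function is determined by its values at the tensors of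
   the empty word, and these list the Fourier coefficients. *)
Lemma char_op_single v a : char_op F (single [::] v) a = theta F a v.
Proof.
pose t : l2 (seq 'I_n) H := L2 (theta_l2 cF v).
rewrite /char_op (_ : lim _ = t)//; apply: cvg_lim; first exact: norm_hausdorff.
by apply: radial_cvg => r b r0 r1; apply: char_r_single.
Qed.

(** The adjoint of [theta F a]. *)
Definition theta_adj a d : l2 'I_n H :=
  if a is i :: b then col_defect F (single i (wprod F b (row_defect F d)))
  else - adjoint (rowop F) d.

Lemma dot_theta a v d : dot (theta F a v) d = dot v (theta_adj a d).
Proof.
case: a => [|i b] /=; first by rewrite dotNl dotNr dot_adjoint.
rewrite row_defect_symmetric// dot_wadj// -(dot_singler i _ (col_defect F v)).
by rewrite col_defect_symmetric.
Qed.

(** The image of e_a (x) d under the adjoint of the Poisson kernel. *)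
Definition poisson_adj a d : H := wprod F a (row_defect F d).

(** The identity K K^* = I - Theta Theta^* in coordinates: the Gram matrix of
   the vectors F_a Delta d is computed from the Fourier coefficients of the
   characteristic function by removing the first letters of both words. *)
Lemma poisson_gram_cons i j a b d e :
  dot (poisson_adj (i :: a) d) (poisson_adj (j :: b) e) =
  (if i == j then dot (poisson_adj a d) (poisson_adj b e) else 0) -
  dot (theta_adj (i :: a) d) (theta_adj (j :: b) e).
Proof.
rewrite /poisson_adj /= -!(rowop_single cF).
rewrite dot_adjoint// col_defect_symmetric// col_defectK// dotBr.
rewrite opprB [dot (single i _) (single j _)]dot_single singleE.
by case: eqP => _; rewrite ?dot0r addrC subrK.
Qed.

Lemma poisson_gram_cons_nil i a d e :
  dot (poisson_adj (i :: a) d) (poisson_adj [::] e) =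
  - dot (theta_adj (i :: a) d) (theta_adj [::] e).
Proof.
rewrite /poisson_adj /= -(rowop_single cF) -row_defect_symmetric//.
by rewrite -rowop_col_defect// dot_adjoint// dotNr opprK.
Qed.

Lemma poisson_gram_nil d e :
  dot (poisson_adj [::] d) (poisson_adj [::] e) =
  dot d e - dot (theta_adj [::] d) (theta_adj [::] e).
Proof.
rewrite /poisson_adj /= row_defect_symmetric// row_defectK// dotBr.
by rewrite -rowop_adjoint// dotNl dotNr opprK dot_adjointl.
Qed.

(** [cnc] as a property of the row F = f(T) alone. *)
Definition completely_non_coisometric : Prop :=
  forall h, (forall m, (0 < m)%N ->
    dot (iter m (fun A h => \sum_i F i (A (adjoint (F i) h))) id h) h = `|h| ^+ 2) ->
  h = 0.

(** When Delta F_a^* h = 0 for all words a, no norm is lost in any step of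
   |h|^2 = |Delta h|^2 + sum_i |F_i^* h|^2. *)
Lemma cnc_poisson_injective : completely_non_coisometric ->
  forall h, (forall a, row_defect F (wadj F a h) = 0) -> h = 0.
Proof.
move=> cnc h h0; apply: cnc => m _; rewrite -dotE.
elim: m h h0 => [//|m IH] h h0 /=.
have h00 : row_defect F h = 0 := h0 [::].
rewrite dot_suml [RHS]dot_nrm -(nrm_row_defect cF) h00 nrm0 expr0n add0r.
rewrite rmorph_sum; apply: eq_bigr => i _; rewrite -[RHS]dot_nrm -IH.
  by rewrite dot_adjoint.
by move=> a; have := h0 (i :: a).
Qed.

(** Completely non-coisometric rows are those whose Poisson kernel is injective,
   that is, whose vectors F_a Delta d span a dense subspace. *)
Lemma poisson_total : completely_non_coisometric ->
  forall h, (forall a d, range (row_defect F) d -> dot h (poisson_adj a d) = 0) ->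
  h = 0.
Proof.
move=> cnc h h0; apply: (cnc_poisson_injective cnc) => a.
have [lrd _] := bounded_opP (row_defect_bounded cF).
apply/nrm_eq0/eqP; rewrite -sqrf_eq0; apply/eqP/complexI.
rewrite -dot_nrm row_defect_symmetric// dot_wadj//.
by apply: (h0 a (row_defect F (wadj F a h))); exists (wadj F a h).
Qed.

End fourier_coefficients.

(** * Unitary operators from Gram matrices *)

Section unitaries.
Variables (R : realType) (H K : hilbertType R).

(** Keeping the inverse explicit makes the relation symmetric in H and K and
   avoids choosing preimages. *)
Definition unitary_pair (U : H -> K) (V : K -> H) : Prop :=
  [/\ linear U, linear V, cancel U V, cancel V U &
      forall x y, dot (U x) y = dot x (V y)].

Lemma dot_unitary U V : unitary_pair U V -> forall x y, dot (U x) (U y) = dot x y.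
Proof. by case=> _ _ UK _ UV x y; rewrite UV UK. Qed.

Lemma nrm_isometry (D : set H) (U : H -> K) :
  (forall x y, D x -> D y -> dot (U x) (U y) = dot x y) ->
  forall x, D x -> nrm (U x) = nrm x.
Proof.
move=> UU x Dx; apply/eqP; rewrite -(@eqrXn2 _ 2)// ?nrm_ge0//.
by apply/eqP/complexI; rewrite -!dot_nrm UU.
Qed.

Lemma nrm_unitary U V : unitary_pair U V -> forall x, nrm (U x) = nrm x.
Proof.
by move=> /dot_unitary UU x; apply: (@nrm_isometry setT) => // y z _ _; apply: UU.
Qed.

Lemma unitary_bounded U V : unitary_pair U V -> bounded_op U.
Proof.
move=> UV; have [lU _ _ _ _] := UV; apply: (@bounded_lin _ _ _ _ lU 1) => // x.
by rewrite (nrm_unitary UV) mul1r.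
Qed.

(** The functional sends a combination of the w_j to the inner product of h with
   the same combination of the v_j. Equality of the Gram matrices makes it
   bounded by the norm of h; given by its graph, it can be represented without
   checking that it is well defined. *)
Lemma gram_representation J (v : J -> H) (w : J -> K) :
  (forall i j, dot (w i) (w j) = dot (v i) (v j)) ->
  forall h, exists z, nrm z <= nrm h /\ forall j, dot (w j) z = dot (v j) h.
Proof.
move=> gram h.
pose comb (L : hilbertType R) (x : J -> L) (c : seq (R[i] * J)) :=
  \sum_(p <- c) p.1 *: x p.2.
have combE c : nrm (comb K w c) = nrm (comb H v c).
  apply/eqP; rewrite -(@eqrXn2 _ 2)// ?nrm_ge0//; apply/eqP/complexI.
  rewrite -!dot_nrm /comb !dot_suml; apply: eq_bigr => p _.
  rewrite !dot_sumr; apply: eq_bigr => q _.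
  by rewrite !dotZl !dotZr gram.
have [|a _ x _ y [c [-> ->]] [d [-> ->]]|_ _ [c [-> ->]]|z zh zE] :=
  @riesz_graph R K (fun s y => exists c, s = dot (comb H v c) h /\ y = comb K w c)
    (nrm h) (nrm_ge0 h).
- by exists [::]; rewrite /comb !big_nil dot0l.
- exists ([seq (a * p.1, p.2) | p <- c] ++ d).
  rewrite /comb !big_cat !big_map dotDl -dotZl !scaler_sumr.
  by split; [congr (dot _ _ + _)|congr (_ + _)]; apply: eq_bigr => p _;
     rewrite scalerA.
- by rewrite combE mulrC Re_dot_le.
exists z; split=> // j; rewrite -(zE (dot (v j) h))//.
by exists [:: (1, j)]; rewrite /comb !big_seq1 !scale1r.
Qed.

End unitaries.

(** Both the operator and its inverse are found by the representation theorem,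
   so nothing has to be extended from the linear span of the vectors; totality
   gives uniqueness, hence linearity and the cancellation laws. *)
Lemma gram_unitary (R : realType) (H K : hilbertType R) J (v : J -> H) (w : J -> K) :
  (forall i j, dot (w i) (w j) = dot (v i) (v j)) ->
  (forall h, (forall j, dot h (v j) = 0) -> h = 0) ->
  (forall k, (forall j, dot k (w j) = 0) -> k = 0) ->
  exists U V, unitary_pair U V /\ forall h j, dot (U h) (w j) = dot h (v j).
Proof.
move=> gram tv tw.
have [U /all_and2[U1 UE]] := choice (gram_representation gram).
have [V /all_and2[V1 VE]] := choice (gram_representation (fun i j => esym (gram i j))).
have {}UE h j : dot (U h) (w j) = dot h (v j) by rewrite dotC UE -dotC.
have {}VE k j : dot (V k) (v j) = dot k (w j) by rewrite dotC VE -dotC.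
have eqv x y : (forall j, dot x (v j) = dot y (v j)) -> x = y.
  move=> xy; apply/eqP; rewrite -subr_eq0; apply/eqP/tv => j.
  by rewrite dotBl xy subrr.
have eqw x y : (forall j, dot x (w j) = dot y (w j)) -> x = y.
  move=> xy; apply/eqP; rewrite -subr_eq0; apply/eqP/tw => j.
  by rewrite dotBl xy subrr.
have UK : cancel U V by move=> h; apply: eqv => j; rewrite VE UE.
have VK : cancel V U by move=> k; apply: eqw => j; rewrite UE VE.
have lU : linear U.
  by move=> a x y; apply: eqw => j; rewrite UE !dotPl !UE.
have lV : linear V.
  by move=> a x y; apply: eqv => j; rewrite VE !dotPl !VE.
have nU h : nrm (U h) = nrm h.
  by apply/eqP; rewrite eq_le U1 -{1}(UK h) V1.
exists U, V; split=> //; split=> // x y.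
rewrite -{1}(VK y); apply: (@Re_dot_inj _ _ (fun x => dot (U x) (U (V y)))).
  by move=> a u; rewrite (linZ lU) dotZl.
move=> u; have := nrm_sqrD (U u) (U (V y)).
by rewrite -(linD lU) !nU nrm_sqrD; lra.
Qed.

Lemma closure_nrmP (R : realType) (H : hilbertType R) (D : set H) x :
  closure D x <-> forall e : R, 0 < e -> exists2 y, D y & nrm (x - y) < e.
Proof.
split=> [Dx e e0|Dx B].
  have [|y [Dy xy]] := Dx (ball x e%:C%C).
    by apply: nbhsx_ballx; rewrite -[0]/(0%:C%C) ltcR.
  by exists y => //; apply/nrm_ball.
move=> /nbhs_ballP[e /= /Rcomplex_gt0[r r0 ->] xB].
by have [y Dy xy] := Dx r r0; exists y; split=> //; apply/xB/nrm_ball.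
Qed.

Lemma bounded_closure (R : realType) (H K : hilbertType R) (A : H -> K) (D : set H) (E : set K) : bounded_op A ->
  (forall x, D x -> E (A x)) -> forall x, closure D x -> closure E (A x).
Proof.
move=> /bounded_opP[lA [c c0 Ac]] DE x /closure_nrmP Dx; apply/closure_nrmP => e e0.
have d0 : 0 < e / (c + 1) by rewrite divr_gt0// ltr_wpDl.
have [y Dy] := Dx _ d0; rewrite ltr_pdivlMr ?ltr_wpDl// => xy.
exists (A y); first exact: DE.
rewrite -(linB lA); apply: le_lt_trans (Ac _) _; apply: le_lt_trans xy.
by rewrite mulrC ler_wpM2l ?nrm_ge0// lerDl.
Qed.

(** * Reconstruction from the characteristic function *)

Section defect_spaces.
Variables (R : realType) (n : nat) (H : hilbertType R) (F : 'I_n -> H -> H).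
Hypothesis cF : row_contraction F.

Definition row_defect_space : set H := closure (range (row_defect F)).
Definition col_defect_space : set (l2 'I_n H) := closure (range (col_defect F)).

Lemma col_defect_space0 : col_defect_space 0.
Proof.
apply: subset_closure; exists 0 => //.
by have [l _] := bounded_opP (col_defect_bounded cF); exact: lin0 l.
Qed.

Lemma theta_defect a v : col_defect_space v -> row_defect_space (theta F a v).
Proof.
have cr := rowop_contraction cF; have br := contraction_bounded cr.
have [lrd _] := bounded_opP (row_defect_bounded cF).
case: a => [|i b] Dv /=; last by apply: subset_closure; eexists.
apply: (bounded_closure (A := fun v => - rowop F v)) Dv.
  apply: (@bounded_lin _ _ _ _ _ 1) => // [c x y|x].
    by rewrite cr.1 opprD scalerN.
  by rewrite nrmN mul1r cr.2.
move=> _ [x _ <-]; exists (- rowop F x) => //.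
by rewrite (linN lrd) rowop_col_defect.
Qed.

Lemma theta_adj_defect a d : row_defect_space d -> col_defect_space (theta_adj F a d).
Proof.
have cr := rowop_contraction cF; have br := contraction_bounded cr.
have ca := adjoint_contraction cr.
have [lcd _] := bounded_opP (col_defect_bounded cF).
case: a => [|i b] Dd /=; last by apply: subset_closure; eexists.
apply: (bounded_closure (A := fun d => - adjoint (rowop F) d)) Dd.
  apply: (@bounded_lin _ _ _ _ _ 1) => // [c x y|x].
    by rewrite ca.1 opprD scalerN.
  by rewrite nrmN mul1r ca.2.
move=> _ [x _ <-]; exists (- adjoint (rowop F) x) => //.
by rewrite (linN lcd) adjoint_row_defect.
Qed.

End defect_spaces.

Section reconstruction.
Variables (R : realType) (n : nat) (H K : hilbertType R).
Variables (F : 'I_n -> H -> H) (G : 'I_n -> K -> K).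
Hypotheses (cF : row_contraction F) (cG : row_contraction G).

(** By induction on both words, from the coordinate form of
   K K^* = I - Theta Theta^*. *)
Lemma poisson_gram_eq (D : set H) (tau : H -> K) :
  (forall d e, D d -> D e -> dot (tau d) (tau e) = dot d e) ->
  (forall a b d e, D d -> D e ->
    dot (theta_adj G a (tau d)) (theta_adj G b (tau e)) =
    dot (theta_adj F a d) (theta_adj F b e)) ->
  forall a b d e, D d -> D e ->
    dot (poisson_adj G a (tau d)) (poisson_adj G b (tau e)) =
    dot (poisson_adj F a d) (poisson_adj F b e).
Proof.
move=> tauD thD; elim=> [|i a IH] [|j b] d e Dd De.
- by rewrite !poisson_gram_nil// thD// tauD.
- rewrite dotC [RHS]dotC; congr (_^*).
  by rewrite !poisson_gram_cons_nil// thD.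
- by rewrite !poisson_gram_cons_nil// thD.
- by rewrite !poisson_gram_cons// thD// IH.
Qed.

Hypotheses (cncF : completely_non_coisometric F)
  (cncG : completely_non_coisometric G).

(** On the tensors of the empty word, coincidence says that tau1 and tau2
   intertwine all Fourier coefficients. On the defect spaces they then
   intertwine the adjoint coefficients, so the vectors F_a Delta d and
   G_a Delta (tau2 d) have the same Gram matrix. *)
Lemma coincide_unitary :
  coincide (col_defect_space F) (row_defect_space F)
           (col_defect_space G) (row_defect_space G) (char_op F) (char_op G) ->
  exists U V, unitary_pair U V /\ forall i h, U (F i h) = G i (U h).
Proof.
move=> [tau1 [tau2 [[lin1 iso1 im1] [_ iso2 im2] eqT]]].
have C0 := col_defect_space0 cF.
have tau10 : tau1 0 = 0.
  have := lin1 1 0 0 C0 C0; rewrite !scale1r addr0 => e.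
  by apply: (addrI (tau1 0)); rewrite addr0 -e.
have thetaE a v : col_defect_space F v -> theta G a (tau1 v) = tau2 (theta F a v).
  move=> Cv.
  have x1 : l2map tau1 (single [::] v) = single [::] (tau1 v) :> l2 (seq 'I_n) _.
    rewrite /l2map; congr to_l2; apply/funext => b; rewrite singleE.
    by case: eqP.
  have Cx b : col_defect_space F ((single [::] v : l2 (seq 'I_n) _) b).
    by rewrite singleE; case: eqP.
  rewrite -(char_op_single cG) -x1 eqT// /l2map to_l2E ?char_op_single//.
  apply: (@mem_l2 _ _ _ _ (nrm (char_op F (single [::] v)) ^+ 2)) => s us.
  apply: le_trans (seq_le_l2_nrm _ us); apply: ler_sum => b _.
  rewrite char_op_single// (nrm_isometry iso2)//.
  exact: theta_defect.
have theta_adjE a d : row_defect_space F d ->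
    theta_adj G a (tau2 d) = tau1 (theta_adj F a d).
  move=> Dd; have Crho := theta_adj_defect (a := a) cF Dd.
  have D2 : row_defect_space G (tau2 d) by rewrite -im2; exists d.
  have := theta_adj_defect (a := a) cG D2; rewrite -im1 => -[v Cv vE].
  have orth u : col_defect_space F u -> dot u (v - theta_adj F a d) = 0.
    move=> Cu; rewrite dotBr -iso1// vE -dot_theta// thetaE// iso2//.
      by rewrite dot_theta// subrr.
    exact: theta_defect.
  rewrite -vE; congr tau1; apply/eqP; rewrite -subr_eq0; apply/eqP/nrm_eq0/eqP.
  rewrite -sqrf_eq0; apply/eqP/complexI; rewrite -dot_nrm dotBl.
  by rewrite !orth// subrr.
pose J := {p : seq 'I_n * H | row_defect_space F p.2}.
pose v (p : J) := poisson_adj F (sval p).1 (sval p).2.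
pose w (p : J) := poisson_adj G (sval p).1 (tau2 (sval p).2).
have [[[a d] /= Dd] [[b e] /= De]|h h0|k k0|U [V [UV UE]]] :=
  @gram_unitary R H K J v w.
- apply: (poisson_gram_eq (D := row_defect_space F)) => // a' b' d' e' Dd' De'.
  by rewrite !theta_adjE// iso1//; exact: theta_adj_defect.
- apply: (poisson_total cF cncF) => a d rd.
  have Dd : row_defect_space F d by apply: subset_closure.
  exact: (h0 (exist _ (a, d) Dd)).
- apply: (poisson_total cG cncG) => a d rd.
  have : row_defect_space G d by apply: subset_closure.
  rewrite -im2 => -[c Dc <-].
  exact: (k0 (exist _ (a, c) Dc)).
exists U, V; split=> // i.
have [lU lV UK VK dUV] := UV; have [bFi bGi] := (cF.1 i, cG.1 i).
(* F_i maps F_a Delta d to F_ia Delta d, so testing against these total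
   vectors gives the relation between the adjoints *)
have UFs h : U (adjoint (F i) h) = adjoint (G i) (U h).
  have wv k (p : J) : dot (U h) (w p) = dot h (v p) by exact: UE.
  have tot k : (forall p : J, dot k (w p) = 0) -> k = 0.
    move=> k0; apply: (poisson_total cG cncG) => a d rd.
    have : row_defect_space G d by apply: subset_closure.
    rewrite -im2 => -[c Dc <-].
    exact: (k0 (exist _ (a, c) Dc)).
  apply/eqP; rewrite -subr_eq0; apply/eqP/tot => -[[a d] /= Dd].
  have := UE (adjoint (F i) h) (exist _ (a, d) Dd).
  have := UE h (exist _ (i :: a, d) Dd).
  rewrite /v /w /poisson_adj /= => e1 e2.
  by rewrite dotBl e2 !dot_adjointl// e1 subrr.
move=> h; apply: dot_inj => k.
rewrite dUV (dot_adjoint _ _ bFi) (dot_adjoint _ _ bGi) dUV.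
by rewrite -{2}(VK k) -UFs UK.
Qed.

End reconstruction.

(** * Transport along a unitary operator *)

Section intertwining.
Variable R : realType.
Implicit Types H K : hilbertType R.

Lemma unitary_pair_sym H K (U : H -> K) (V : K -> H) :
  unitary_pair U V -> unitary_pair V U.
Proof.
by move=> [lU lV UK VK UV]; split=> // x y; rewrite dotC -UV -dotC.
Qed.

Lemma l2map_unitary (I : choiceType) H K (U : H -> K) (V : K -> H) :
  unitary_pair U V -> unitary_pair (@l2map R I _ _ U) (@l2map R I _ _ V).
Proof.
move=> UV; have [lU lV UK VK dUV] := UV.
have bU := unitary_bounded UV; have bV := unitary_bounded (unitary_pair_sym UV).
split; [exact: l2map_linear|exact: l2map_linear| | |].
- by move=> x; apply: l2E => i; rewrite !l2mapE.
- by move=> x; apply: l2E => i; rewrite !l2mapE.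
move=> x y; rewrite [LHS]/(l2dot _ _) [RHS]/(l2dot _ _) /l2dot.
by congr (_ +i* _)%C; congr rsum; apply/funext => i; rewrite !l2mapE// dUV.
Qed.

(** Unitarity of both outer operators is essential here: a mere intertwiner of A
   and B does not intertwine the adjoints. *)
Lemma adjoint_intertwine H K (H1 K1 : hilbertType R) (U : H -> K) (V : K -> H)
    (U1 : H1 -> K1) (V1 : K1 -> H1) (A : H -> H1) (B : K -> K1) :
  unitary_pair U V -> unitary_pair U1 V1 -> bounded_op A -> bounded_op B ->
  (forall x, U1 (A x) = B (U x)) ->
  forall y, U (adjoint A y) = adjoint B (U1 y).
Proof.
move=> [lU lV UK VK UV] [lU1 lV1 UK1 VK1 UV1] bA bB AB y.
apply: dot_inj => x; rewrite UV !dot_adjointl// UV1.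
by rewrite -[in RHS](VK x) -AB UK1.
Qed.

Lemma unitary_on_range H K (U : H -> K) (V : K -> H) (A : H -> H) (B : K -> K) :
  unitary_pair U V -> (forall x, U (A x) = B (U x)) ->
  unitary_on (closure (range A)) (closure (range B)) U.
Proof.
move=> UV AB; have [lU lV UK VK dUV] := UV.
split=> [a x y _ _|x y _ _|]; [exact: lU|exact: dot_unitary UV _ _|].
apply/seteqP; split=> [_ [x Ax <-]|y By].
  apply: bounded_closure Ax; first exact: unitary_bounded UV.
  by move=> _ [z _ <-]; exists (U z).
exists (V y) => //; apply: bounded_closure By.
  exact: unitary_bounded (unitary_pair_sym UV).
by move=> _ [z _ <-]; exists (V z) => //; rewrite -[LHS]UK AB VK.
Qed.

(** This holds for divergent families as well: the default value of a limit in
   a space of square-summable families is 0, which U preserves. *)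
Lemma lim_unitary H K (I : choiceType) (U : l2 I H -> l2 I K) (V : l2 I K -> l2 I H)
    T (F : set_system T) {FF : ProperFilter F} (u : T -> l2 I H) (w : T -> l2 I K) :
  unitary_pair U V -> (\forall t \near F, w t = U (u t)) ->
  lim (w t @[t --> F]) = U (lim (u t @[t --> F])).
Proof.
move=> UV wu; have bU := unitary_bounded UV.
have [lU lV UK VK dUV] := UV.
have wU l : u @ F --> l -> w @ F --> U l.
  move=> /(bounded_cvg bU); apply: cvg_trans.
  by apply: near_eq_cvg; apply: filterS wu => t ->.
have [/cvg_ex[l ul]|du] := pselect (cvg (u @ F)).
  rewrite (cvg_lim (@norm_hausdorff _ _) ul).
  by apply: cvg_lim (wU _ ul); exact: norm_hausdorff.
rewrite (dvgP du) dvgP; first exact: (esym (lin0 lU)).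
move=> /cvg_ex[l wl]; apply: du; apply/cvg_ex; exists (V l).
have bV := unitary_bounded (unitary_pair_sym UV).
apply: cvg_trans (bounded_cvg bV wl); apply: near_eq_cvg.
by apply: filterS wu => t ->; rewrite UK.
Qed.

End intertwining.

Section transport.
Variables (R : realType) (n : nat) (H K : hilbertType R).
Variables (F : 'I_n -> H -> H) (G : 'I_n -> K -> K).
Hypotheses (cF : row_contraction F) (cG : row_contraction G).
Variables (U : H -> K) (V : K -> H).
Hypotheses (UV : unitary_pair U V) (UF : forall i h, U (F i h) = G i (U h)).

Let bU := unitary_bounded UV.
Local Notation Un := (@l2map R 'I_n _ _ U).
Local Notation Uw := (@l2map R (seq 'I_n) _ _ U).

Let UVn : unitary_pair Un (l2map V) := l2map_unitary 'I_n UV.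
Let UVw : unitary_pair Uw (l2map V) := l2map_unitary (seq 'I_n) UV.
Let bUn := unitary_bounded UVn.
Let crF := rowop_contraction cF.
Let crG := rowop_contraction cG.

Lemma rowop_unitary x : U (rowop F x) = rowop G (Un x).
Proof.
have [lU _ _ _ _] := UV.
by rewrite /rowop (lin_sum lU); apply: eq_bigr => i _; rewrite l2mapE// UF.
Qed.

Lemma adjoint_unitary i h : U (adjoint (F i) h) = adjoint (G i) (U h).
Proof. exact: adjoint_intertwine UV UV (cF.1 i) (cG.1 i) (UF i) h. Qed.

Lemma row_defect_unitary h : U (row_defect F h) = row_defect G (U h).
Proof.
have [lU _ _ _ _] := UV.
apply: (sqrt_op_intertwine (row_gram_contraction cF) (row_gram_symmetric cF)
  (row_gram_contraction cG) (row_gram_symmetric cG) bU) => x.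
by rewrite (lin_sum lU); apply: eq_bigr => i _; rewrite UF adjoint_unitary.
Qed.

Lemma col_defect_unitary x : Un (col_defect F x) = col_defect G (Un x).
Proof.
apply: (sqrt_op_intertwine (contraction_adjoint_comp crF)
  (symmetric_adjoint_comp crF) (contraction_adjoint_comp crG)
  (symmetric_adjoint_comp crG) bUn) => y /=.
rewrite (adjoint_intertwine UVn UV (contraction_bounded crF)
  (contraction_bounded crG) rowop_unitary).
by rewrite rowop_unitary.
Qed.

Lemma row_shift_unitary (L M : hilbertType R) (r : R) (A : 'I_n -> L -> H)
    (B : 'I_n -> M -> K) (W : L -> M) (y : l2 (seq 'I_n) L) :
  (forall i, bounded_op (A i)) -> (forall i, bounded_op (B i)) -> bounded_op W ->
  (forall i x, U (A i x) = B i (W x)) ->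
  Uw (row_shift r A y) = row_shift r B (l2map W y).
Proof.
move=> bA bB bW AB; have [lU _ _ _ _] := UV.
apply: l2E; case/lastP => [|b i].
  by rewrite l2mapE// !row_shift_nil// (lin0 lU).
by rewrite l2mapE// !row_shift_rcons// (linZ lU) AB l2mapE.
Qed.

Lemma char_r_unitary (r : R) x : 0 <= r -> r < 1 ->
  char_r G r (l2map Un x) = Uw (char_r F r x).
Proof.
move=> r0 r1; have [lUw _ _ _ _] := UVw.
have [_ LF _] := char_resolvent cF r0 r1; have [_ _ IG] := char_resolvent cG r0 r1.
have bFs i : bounded_op (adjoint (F i)) := bounded_adjoint (cF.1 i).
have bGs i : bounded_op (adjoint (G i)) := bounded_adjoint (cG.1 i).
have bP (L : hilbertType R) i : bounded_op (fun v : l2 'I_n L => v i).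
  exact: l2_coord_bounded.
rewrite /char_r (linD lUw) (linN lUw); congr (- _ + _).
  apply: l2E => a; rewrite !l2mapE ?rowop_unitary//; exact: contraction_bounded.
rewrite -/(row_shift r (fun i (v : l2 'I_n K) => v i) _).
rewrite -/(row_shift r (fun i (v : l2 'I_n H) => v i) _).
have -> : row_shift r (fun i (v : l2 'I_n K) => v i)
      (l2map (col_defect G) (l2map Un x)) =
    Uw (row_shift r (fun i (v : l2 'I_n H) => v i) (l2map (col_defect F) x)).
  have Uc i (v : l2 'I_n H) : U (v i) = Un v i by rewrite l2mapE.
  rewrite (row_shift_unitary r _ (bP H) (bP K) bUn Uc).
  congr row_shift; apply: l2E => a; rewrite !l2mapE ?col_defect_unitary//.
  - exact: col_defect_bounded.
  - exact: col_defect_bounded.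
set w := row_shift _ _ _.
rewrite -{1}(LF w) (linB lUw).
rewrite (row_shift_unitary r _ bFs bGs bU adjoint_unitary).
rewrite [inv_op _ _]IG.
apply: l2E => a; rewrite !l2mapE ?row_defect_unitary//; exact: row_defect_bounded.
Qed.

Lemma unitary_coincide :
  coincide (col_defect_space F) (row_defect_space F)
           (col_defect_space G) (row_defect_space G) (char_op F) (char_op G).
Proof.
exists Un, U; split.
- exact: unitary_on_range UVn col_defect_unitary.
- exact: unitary_on_range UV row_defect_unitary.
move=> x _; apply: (lim_unitary UVw).
near=> r; apply: char_r_unitary.
- by near: r; apply: nbhs_left_ge; exact: ltr01.
- by near: r; exact: nbhs_left_lt.
Unshelve. all: by end_near.
Qed.

End transport.

(** * Power series in operators *)

Section abel.
Variables (R : realType) (H : hilbertType R) (u : nat -> H) (L : H).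

Let s m := \sum_(k < m.+1) u k.
Let sr (r : R) m := \sum_(k < m.+1) (r ^+ k)%:C%C *: u k.

(** Summation by parts, in terms of the remainders L - s k. *)
Lemma abel_summation (r : R) m : L - sr r m =
  (1 - r)%:C%C *: (\sum_(k < m) (r ^+ k)%:C%C *: (L - s k)) +
  (r ^+ m)%:C%C *: (L - s m).
Proof.
elim: m => [|m IH].
  by rewrite /sr /s big_ord0 !big_ord1 scaler0 add0r !expr0 !scale1r.
have -> : L - sr r m.+1 = L - sr r m - (r ^+ m.+1)%:C%C *: u m.+1.
  by rewrite /sr [in LHS]big_ord_recr /= opprD addrA.
have -> : u m.+1 = (L - s m) - (L - s m.+1).
  by rewrite opprB addrC subrKA /s [in RHS]big_ord_recr /= [RHS]addrC addKr.
rewrite IH big_ord_recr /=; move: (L - s m) (L - s m.+1) => x y.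
rewrite [in RHS]scalerDr scalerBr opprB -!addrA; congr (_ + _).
rewrite scalerA -rmorphM/= mulrBl mul1r -exprS rmorphB/= scalerBl.
by rewrite [RHS]addrAC addrA.
Qed.

(** Abel's theorem: by the summation formula, the remainders of small index
   contribute at most a constant times 1 - r, and the others at most e / 2. *)
Lemma abel (S : R -> H) : s @ \oo --> L ->
  (forall r : R, 0 <= r -> r < 1 -> sr r @ \oo --> S r) ->
  S r @[r --> (1 : R)^'-] --> L.
Proof.
move=> /cvg_nrm_seqP sL srS; apply/cvg_nrmP => e e0.
have e2 : 0 < e / 2 by rewrite divr_gt0.
have [N hN] := sL _ e2.
pose M := \sum_(k < N) nrm (L - s k).
have M0 : 0 <= M by apply: sumr_ge0 => k _; exact: nrm_ge0.
have d0 : 0 < e / 2 / (M + 1) by rewrite divr_gt0// ltr_wpDl.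
have near1 : \forall r \near (1 : R)^'-, [/\ 0 <= r, r < 1 & 1 - r < e / 2 / (M + 1)].
  near=> r; split.
  - by near: r; apply: nbhs_left_ge; exact: ltr01.
  - by near: r; exact: nbhs_left_lt.
  - rewrite ltrBlDr -ltrBlDl; near: r; apply: nbhs_left_gt.
    by rewrite ltrBlDr ltrDl.
apply: filterS near1 => r [r0 r1 rd].
have d1 : 0 <= 1 - r by rewrite subr_ge0 ltW.
have head j : (1 - r) * (\sum_(k < N + j) r ^+ k * nrm (L - s k)) <=
    (1 - r) * M + e / 2 * (r ^+ N - r ^+ (N + j)).
  elim: j => [|j IH].
    rewrite addn0 subrr mulr0 addr0 ler_wpM2l//; apply: ler_sum => k _.
    by rewrite ler_piMl ?nrm_ge0// exprn_ile1// ltW.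
  rewrite addnS big_ord_recr /= mulrDr.
  have h := ltW (hN (N + j)%N (leq_addr _ _)).
  have rN : 0 <= r ^+ (N + j) by exact: exprn_ge0.
  have := ler_wpM2l (mulr_ge0 d1 rN) h.
  by rewrite exprS; lra.
have bound : nrm (L - S r) <= (1 - r) * M + e / 2.
  apply: (@nrm_cvg_le _ _ _ \oo _ (fun m => L - sr r m)).
    exact: cvgB (cvg_cst _) (srS r r0 r1).
  exists N => // m /= Nm; rewrite abel_summation.
  apply: le_trans (nrmD _ _) _; rewrite !nrmZr !ger0_norm ?exprn_ge0//.
  apply: le_trans (lerD (ler_wpM2l d1 (nrm_sum _ _ _)) (lexx _)) _.
  have := head (m - N)%N; rewrite subnKC// => hm.
  have h := ler_wpM2l (exprn_ge0 m r0) (ltW (hN m Nm)).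
  under eq_bigr do rewrite nrmZr ger0_norm ?exprn_ge0//.
  have rN : r ^+ N <= 1 by rewrite exprn_ile1// ltW.
  have := ler_wpM2l (ltW e2) rN.
  by move: hm h; rewrite mulrBr mulr1; lra.
apply: le_lt_trans bound _.
by move: rd; rewrite ltr_pdivlMr ?ltr_wpDl//; lra.
Unshelve. all: by end_near.
Qed.

End abel.

Section evaluation.
Variables (R : realType) (n : nat).
Implicit Types (H K : hilbertType R) (p : fps R n) (f : 'I_n -> fps R n).

Lemma sot_conv_fval H p (Y : 'I_n -> H -> H) : sot_conv p Y ->
  bounded_op (fval p Y) /\ forall h, psum p Y m h @[m --> \oo] --> fval p Y h.
Proof.
move=> [L bL Llim]; have -> : fval p Y = L.
  by apply/funext => h; apply: cvg_lim (Llim h); exact: norm_hausdorff.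
by [].
Qed.

Lemma rad_conv_radval H p (Y : 'I_n -> H -> H) : rad_conv p Y ->
  bounded_op (radval p Y) /\
  forall h, fval p (rscale r Y) h @[r --> (1 : R)^'-] --> radval p Y h.
Proof.
move=> [_ [L bL Llim]]; have -> : radval p Y = L.
  by apply/funext => h; apply: cvg_lim (Llim h); exact: norm_hausdorff.
by [].
Qed.

Lemma wprod_linear H (Y : 'I_n -> H -> H) a :
  (forall i, linear (Y i)) -> linear (wprod Y a).
Proof. by move=> lY; elim: a => [//|i a IH] c x y /=; rewrite IH lY. Qed.

Lemma wprod_rscale H (Y : 'I_n -> H -> H) (r : R) a h :
  (forall i, linear (Y i)) ->
  wprod (rscale r Y) a h = (r ^+ size a)%:C%C *: wprod Y a h.
Proof.
move=> lY; elim: a => [|i a IH] /=; first by rewrite scale1r.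
by rewrite IH /rscale (linZ (lY i)) scalerA -rmorphM/= -exprS.
Qed.

Lemma psum_linear H p (Y : 'I_n -> H -> H) m :
  (forall i, linear (Y i)) -> linear (psum p Y m).
Proof.
move=> lY c x y; rewrite /psum scaler_sumr -big_split; apply: eq_bigr => k _ /=.
rewrite scaler_sumr -big_split; apply: eq_bigr => a _ /=.
by rewrite wprod_linear// scalerDr !scalerA mulrC.
Qed.

Lemma norm_conv_cvg H p (Y : 'I_n -> H -> H) h :
  (forall i, linear (Y i)) -> norm_conv p Y ->
  psum p Y m h @[m --> \oo] --> fval p Y h.
Proof.
move=> lY [L [lL _] Llim].
suff PL : psum p Y m h @[m --> \oo] --> L h.
  by rewrite /fval (cvg_lim (@norm_hausdorff _ _) PL).
apply/cvg_nrmP => e e0.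
have d0 : 0 < e / (nrm h + 1) by rewrite divr_gt0// ltr_wpDl// nrm_ge0.
have : \forall m \near \oo,
    (opnorm (fun h => (psum p Y m h - L h)%R) < (e / (nrm h + 1))%:E)%E.
  by apply: (Llim _ (open_ereal_lt' _)); rewrite lte_fin.
apply: filterS => m /ltW hm.
have lm : linear (fun h => psum p Y m h - L h).
  by apply: linear_sub lL; exact: psum_linear.
have := (opnorm_leP lm (ltW d0)).1 hm h; rewrite nrm_distC => /le_lt_trans; apply.
by rewrite mulrAC ltr_pdivrMr ?ltr_wpDl ?nrm_ge0// ltr_pM2l// ltrDl.
Qed.

Section unitary.
Variables (H K : hilbertType R) (U : H -> K) (V : K -> H).
Variables (Y : 'I_n -> H -> H) (Z : 'I_n -> K -> K).
Hypotheses (UV : unitary_pair U V) (UY : forall i h, U (Y i h) = Z i (U h)).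

Lemma psum_unitary p m h : U (psum p Y m h) = psum p Z m (U h).
Proof.
have [lU _ _ _ _] := UV.
have wU a x : U (wprod Y a x) = wprod Z a (U x).
  by elim: a => [//|i a IH] /=; rewrite UY IH.
rewrite /psum (lin_sum lU); apply: eq_bigr => k _.
rewrite (lin_sum lU); apply: eq_bigr => a _.
by rewrite (linZ lU) wU.
Qed.

Lemma fval_unitary p h : psum p Y m h @[m --> \oo] --> fval p Y h ->
  psum p Z m (U h) @[m --> \oo] --> fval p Z (U h) /\
  U (fval p Y h) = fval p Z (U h).
Proof.
move=> /(bounded_cvg (unitary_bounded UV)).
under eq_fun do rewrite psum_unitary.
move=> lim; have -> : fval p Z (U h) = U (fval p Y h).
  by apply: cvg_lim lim; exact: norm_hausdorff.
by [].
Qed.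

Lemma sot_conv_unitary p : sot_conv p Y -> sot_conv p Z.
Proof.
move=> [L bL Llim]; have [_ _ UK VK _] := UV.
have bU := unitary_bounded UV; have bV := unitary_bounded (unitary_pair_sym UV).
exists (U \o (L \o V)); first exact: bounded_comp bU (bounded_comp bL bV).
move=> k; rewrite -{1}(VK k) /=.
under eq_fun do rewrite -psum_unitary.
exact: bounded_cvg (Llim _).
Qed.

End unitary.

(** The sums and the radial limits that define f(Y) are pointwise limits of
   noncommutative polynomials in Y, and the case distinction in [feval] is
   invariant under unitary equivalence. *)
Lemma feval_unitary H K (U : H -> K) (V : K -> H) f (Y : 'I_n -> H -> H)
    (Z : 'I_n -> K -> K) :
  unitary_pair U V -> (forall i h, U (Y i h) = Z i (U h)) ->
  (forall i, bounded_op (Y i)) -> sot_dom f Y \/ rad_dom f Y ->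
  forall i h, U (feval f Y i h) = feval f Z i (U h).
Proof.
move=> UV UY bY domY i h; rewrite /feval.
have VU := unitary_pair_sym UV; have [lU _ UK VK _] := UV.
have VZ j k : V (Z j k) = Y j (V k) by rewrite -{1}(VK k) -UY UK.
have lY j : linear (Y j) by case: (bY j).
have -> : `[< sot_dom f Z >] = `[< sot_dom f Y >].
  apply/asboolP/asboolP => d j; first exact: sot_conv_unitary VU VZ _ (d j).
  exact: sot_conv_unitary UV UY _ (d j).
case: asboolP => [sY|nY].
  have [_ lim] := sot_conv_fval (sY i).
  by have [_ ->] := fval_unitary UV UY (lim h).
have {domY nY} [//|rY] := domY.
have [_ lim] := rad_conv_radval (rY i); have [[d /andP[d0 d1] nc] _] := rY i.
symmetry; apply: cvg_lim; first exact: norm_hausdorff.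
apply: cvg_trans (bounded_cvg (unitary_bounded UV) (lim h)).
apply: near_eq_cvg; near=> r.
have lrY j : linear (rscale r Y j).
  by move=> c x y; rewrite /rscale lY scalerDr !scalerA mulrC.
have UrY j x : U (rscale r Y j x) = rscale r Z j (U x).
  by rewrite /rscale (linZ lU) UY.
have [|_ ->//] := fval_unitary (p := f i) UV UrY (h := h).
apply: norm_conv_cvg => //; apply: nc; apply/andP; split.
- by near: r; exact: nbhs_left_gt.
- by near: r; exact: nbhs_left_lt.
Unshelve. all: by end_near.
Qed.

Lemma poly_in_H2 p : is_poly p -> in_H2 p.
Proof.
move=> [N pN].
pose W := undup (flatten [seq [seq val a | a <- enum {: k.-tuple 'I_n}] | k <- iota 0 N.+1]).
apply: (@mem_l2 _ _ _ _ (\sum_(a <- W) nrm (p a : Cspace R) ^+ 2)) => s us.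
rewrite (bigID (fun a => size a <= N)%N)/= [X in _ + X]big1 => [|a]; last first.
  by rewrite -ltnNge => /pN ->; rewrite nrm0 expr0n.
rewrite addr0 -big_filter.
apply: ler_sum_subset; rewrite ?filter_uniq ?undup_uniq// => a; last exact: sqr_ge0.
rewrite mem_filter mem_undup => /andP[aN _]; apply/flattenP.
exists [seq val b | b <- enum {: (size a).-tuple 'I_n}].
  by apply/mapP; exists (size a) => //; rewrite mem_iota.
by apply/mapP; exists (in_tuple a) => //; rewrite mem_enum.
Qed.

Lemma class_Mb_inverse_in_H2 f g MZ : class_Mb f g MZ ->
  forall i, @in_H2 R n (g i).
Proof.
move=> [fM _] i; case: fM => [[_ pg _ _ _]|[_ _ _ h _]|[r _ [_ h _ _ _]]].
- exact: poly_in_H2.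
- by have [] := h i.
- exact: h.
Qed.

Section inverse.
Variables (H : hilbertType R) (F : 'I_n -> H -> H) (p : fps R n).
Hypotheses (cF : row_contraction F) (p2 : in_H2 p).

Let lF i : linear (F i) := (cF.1 i).1.
Let hom k h : H := \sum_(a : k.-tuple 'I_n) p a *: wprod F a h.
Let P : H2 R n := L2 p2.

(** The homogeneous parts of p(F) are uniformly bounded, by Cauchy-Schwarz for
   the row of all words of a given length. *)
Lemma nrm_homogeneous_le k h : nrm (hom k h) <= nrm P * nrm h.
Proof.
apply: nrm_le_dot => [|w]; first by rewrite mulr_ge0 ?nrm_ge0.
pose x : l2 {: k.-tuple 'I_n} H := to_l2 (fun a : k.-tuple 'I_n => p a *: h).
pose y : l2 {: k.-tuple 'I_n} H := to_l2 (fun a : k.-tuple 'I_n => wadj F a w).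
have xE a : x a = p a *: h by apply: to_l2E; exact: mem_l2_fin.
have yE a : y a = wadj F a w by apply: to_l2E; exact: mem_l2_fin.
have -> : dot (hom k h) w = dot x y.
  rewrite /hom dot_suml dot_l2_fin; apply: eq_bigr => a _.
  by rewrite xE yE !dotZl dot_wprod.
have us : uniq [seq val a | a <- enum {: k.-tuple 'I_n}].
  by rewrite map_inj_uniq ?enum_uniq//; exact: val_inj.
apply: le_trans (Re_dot_le _ _) (ler_pM (nrm_ge0 _) (nrm_ge0 _) _ _).
  rewrite -(@ler_pXn2r _ 2) ?nnegrE ?mulr_ge0 ?nrm_ge0// nrm_l2_fin exprMn.
  under eq_bigr do rewrite xE nrmZ exprMn.
  rewrite -mulr_suml ler_wpM2r ?sqr_ge0//.
  have := seq_le_l2_nrm P us; rewrite big_map big_enum/=.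
  by under eq_bigr do rewrite nrm_complexE.
rewrite -(@ler_pXn2r _ 2) ?nnegrE ?nrm_ge0// nrm_l2_fin.
under eq_bigr do rewrite yE.
have := sum_wadj cF w us (k := k); rewrite big_map big_enum; apply.
by apply/allP => _ /mapP[a _ ->]; rewrite size_tuple.
Qed.

Lemma psum_rscale (r : R) m h :
  psum p (rscale r F) m h = \sum_(k < m.+1) (r ^+ k)%:C%C *: hom k h.
Proof.
apply: eq_bigr => k _; rewrite scaler_sumr; apply: eq_bigr => a _.
by rewrite wprod_rscale// size_tuple !scalerA mulrC.
Qed.

Lemma psum_rscale_cvg (r : R) h : 0 <= r -> r < 1 ->
  psum p (rscale r F) m h @[m --> \oo] --> fval p (rscale r F) h.
Proof.
move=> r0 r1; have d0 : 0 < 1 - r by rewrite subr_gt0.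
pose c := nrm P * nrm h.
have c0 : 0 <= c by rewrite mulr_ge0 ?nrm_ge0.
have [k|k|l lim _] := @cvg_dominated_increments _ _
  (fun m => psum p (rscale r F) m h) (fun m => c * (r * (1 - r ^+ m) / (1 - r)))
  (c * (r / (1 - r))).
- rewrite !psum_rscale [in X in nrm X]big_ord_recr /= addrAC subrr add0r.
  rewrite nrmZr ger0_norm ?exprn_ge0//.
  have -> : c * (r * (1 - r ^+ k.+1) / (1 - r)) - c * (r * (1 - r ^+ k) / (1 - r)) =
      r ^+ k.+1 * c by rewrite exprS; field; rewrite gt_eqF.
  by rewrite ler_wpM2l ?exprn_ge0// nrm_homogeneous_le.
- rewrite ler_wpM2l// ler_wpM2r ?invr_ge0 ?(ltW d0)// ler_piMr//.
  by rewrite gerBl exprn_ge0.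
by rewrite /fval (cvg_lim (@norm_hausdorff _ _) lim).
Qed.

Lemma radial_of_sot h (l : H) : psum p F m h @[m --> \oo] --> l ->
  fval p (rscale r F) h @[r --> (1 : R)^'-] --> l.
Proof.
move=> lim; apply: (@abel _ _ (fun k => hom k h)) => // r r0 r1.
under eq_fun do rewrite -psum_rscale.
exact: psum_rscale_cvg.
Qed.

End inverse.

End evaluation.

Section equivalence_through_inverse.
Variables (R : realType) (n : nat) (H K : hilbertType R).
Variables (g : 'I_n -> fps R n).
Hypothesis g2 : forall i, in_H2 (g i).

(** The two ways in which g(E) = S can hold are reconciled by Abel's theorem,
   as the first one may be satisfied by one tuple and the second one by the
   other. *)
Lemma inverse_at_radial (L : hilbertType R) (E S : 'I_n -> L -> L) :
  row_contraction E -> inverse_at g E S ->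
  forall i h, fval (g i) (rscale r E) h @[r --> (1 : R)^'-] --> S i h.
Proof.
by move=> cE [sot|//] i h; apply: radial_of_sot.
Qed.

Lemma inverse_at_unitary (F T : 'I_n -> H -> H) (G S : 'I_n -> K -> K)
    (U : H -> K) (V : K -> H) :
  unitary_pair U V -> row_contraction F -> row_contraction G ->
  (forall i h, U (F i h) = G i (U h)) ->
  inverse_at g F T -> inverse_at g G S ->
  forall i h, U (T i h) = S i (U h).
Proof.
move=> UV cF cG UF iF iG i h; have [lU _ _ _ _] := UV.
have limF : U (fval (g i) (rscale r F) h) @[r --> (1 : R)^'-] --> U (T i h).
  by apply: bounded_cvg (unitary_bounded UV) _; exact: inverse_at_radial.
apply: limit_unique limF _.
apply: cvg_trans (inverse_at_radial cG iG (i := i) (h := U h)).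
apply: near_eq_cvg; near=> r.
have UrF j x : U (rscale r F j x) = rscale r G j (U x).
  by rewrite /rscale (linZ lU) UF.
have [|_ ->//] := fval_unitary (p := g i) UV UrF (h := h).
apply: psum_rscale_cvg => //.
by near: r; apply: nbhs_left_ge; exact: ltr01.
Unshelve. all: by end_near.
Qed.

End equivalence_through_inverse.

(** * The classification theorem *)

Lemma unitary_on_inverse (R : realType) (H K : hilbertType R) (U : H -> K) :
  unitary_on setT setT U -> exists V, unitary_pair U V.
Proof.
move=> [lin iso im].
have lU : linear U by move=> a x y; exact: lin.
have ex k : exists h, U h = k.
  have : [set: K] k by exact: Logic.I.
  by rewrite -im => -[h _ hk]; exists h.
have [V VK] := choice ex; exists V.
have UV x y : dot (U x) y = dot x (V y) by rewrite -{1}(VK y) iso.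
have UK : cancel U V by move=> x; apply: dot_injr => y; rewrite -UV iso.
split=> // a x y; apply: dot_injr => z.
by rewrite -UV !dotDr !dotZr -!UV.
Qed.

Lemma Bf_row_contraction (R : realType) (n : nat) (H : hilbertType R)
    (f g : 'I_n -> fps R n) (T : 'I_n -> H -> H) :
  Bf f g T -> row_contraction (feval f T).
Proof.
move=> [_ dom fT _]; split=> // i; rewrite /feval.
case: asboolP => [sT|nT]; first by case: (sot_conv_fval (sT i)).
by case: dom => // rT; case: (rad_conv_radval (rT i)).
Qed.

Theorem theorem2p4 (R : realType) (n : nat) (n_gt0 : (0 < n)%N)
    (f g : 'I_n -> fps R n) (MZ : 'I_n -> H2 R n -> H2 R n)
    (H H' : hilbertType R) (T : 'I_n -> H -> H) (T' : 'I_n -> H' -> H') :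
  class_Mb f g MZ -> Bf_cnc f g T -> Bf_cnc f g T' ->
  unitarily_equivalent T T' <->
  coincide (defect_star f T) (defect f T)
           (defect_star f T') (defect f T')
           (charfun f T) (charfun f T').
Proof.
move=> fM [BT cncT] [BT' cncT'].
have cF := Bf_row_contraction BT; have cG := Bf_row_contraction BT'.
have [bT domT _ iT] := BT; have [_ _ _ iT'] := BT'.
split=> [[U /unitary_on_inverse[V UV] UT]|co].
  have UTh i h : U (T i h) = T' i (U h) by exact: (congr1 (fun A => A h) (UT i)).
  exact: (unitary_coincide cF cG UV (feval_unitary UV UTh bT domT)).
have [U [V [UV UF]]] := coincide_unitary cF cG cncT cncT' co.
exists U; last first.
  move=> i; apply/funext => h /=.
  exact: (inverse_at_unitary (class_Mb_inverse_in_H2 fM) UV cF cG UF iT iT').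
have [lU _ _ VK _] := UV; split=> [a x y _ _|x y _ _|]; first exact: lU.
  exact: dot_unitary UV _ _.
by apply/seteqP; split=> // k _; exists (V k).
Qed.
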